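(* Let $(\Sigma,T)$ be a closed triangulated surface with vertex set $V=\{1,\dots,|V|\}$, edge set $E$ and triangle set $F$, and let $I\in\mathbb{R}^{|E|}$ be a weight with $I_{ij}\in[0,\infty)$ for every edge $ij\in E$. (Euclidean case) Let $\mathcal{R}_E\subset\mathbb{R}^{|V|}_{>0}$ be the open set of Euclidean-admissible radius vectors, and let $a:\mathcal{R}_E\to\mathbb{R}^{|V|}$ be the Euclidean cone-angle map. Then $a(cr)=a(r)$ for all $c>0$. Moreover, the restriction of $a$ to the normalized set $\{r\in\mathcal{R}_E:\prod_{i} r_i=1\}$ is a local diffeomorphism into the hyperplane $\{x\in\mathbb{R}^{|V|}:\sum_i x_i=\pi|F|\}$. Consequently, every $r\in\mathcal{R}_E$ has a neighborhood $U$ such that any $r'\in U$ with $a(r')=a(r)$ is a positive scalar multiple of $r$. That is, a Euclidean inversive distance circle packing is locally determined by its cone angles up to similarity. (Hyperbolic case) Let $\mathcal{R}_H\subset\mathbb{R}^{|V|}_{>0}$ be the open set of hyperbolic-admissible radius vectors, and let $a:\mathcal{R}_H\to\mathbb{R}^{|V|}$ be the hyperbolic cone-angle map. Then $a$ is a local diffeomorphism. In particular, it is locally injective, so a hyperbolic inversive distance circle packing is locally determined by its cone angles.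
   Context: Edge lengths. Given a radius vector $r=(r_1,\dots,r_{|V|})\in\mathbb{R}^{|V|}_{>0}$, assign to each edge $ij\in E$ a length $l_{ij}$. In Euclidean geometry, $$l_{ij}=\sqrt{r_i^2+r_j^2+2r_ir_jI_{ij}}.$$ In hyperbolic geometry, $l_{ij}>0$ is defined by $$\cosh l_{ij}=\cosh r_i\cosh r_j+I_{ij}\sinh r_i\sinh r_j.$$ These are the distances between the centers of two circles of radii $r_i,r_j$ whose inversive distance is $I_{ij}$. Admissible radius vectors. A radius vector $r$ is Euclidean-admissible (respectively hyperbolic-admissible) if, for every triangle $\triangle ijk\in F$, the three numbers $l_{ij},l_{jk},l_{ki}$ satisfy the strict triangle inequalities. Cone angles. For an admissible $r$, realize each triangle $\triangle ijk\in F$ as a Euclidean (respectively hyperbolic) triangle with side lengths $l_{ij},l_{jk},l_{ki}$. The cone angle $a_i(r)$ at a vertex $i$ is the sum of the inner angles at $i$ of all triangles of $F$ that contain $i$. *)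

(* Defs.v *)
From Stdlib Require Import Reals Lra Lia List Arith Relations.
Import ListNotations.
Open Scope R_scope.

(* Vectors in R^n are represented as functions nat -> R; only the      *)
(* coordinates 0..n-1 are meaningful. All sets/maps below only depend   *)
(* on these coordinates.                                                 *)

Definition eqn (n : nat) (x y : nat -> R) : Prop :=
  forall i, (i < n)%nat -> x i = y i.

Definition ball (n : nat) (x : nat -> R) (eps : R) (y : nat -> R) : Prop :=
  forall i, (i < n)%nat -> Rabs (y i - x i) < eps.

Definition open_n (n : nat) (U : (nat -> R) -> Prop) : Prop :=
  forall x, U x -> exists eps, 0 < eps /\ forall y, ball n x eps y -> U y.

Definition cont_on (n : nat) (U : (nat -> R) -> Prop) (h : (nat -> R) -> R) : Prop :=
  forall x, U x -> forall eps, 0 < eps ->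
    exists d, 0 < d /\ forall y, U y -> ball n x d y -> Rabs (h y - h x) < eps.

Definition upd (x : nat -> R) (i : nat) (t : R) : nat -> R :=
  fun j => if Nat.eqb j i then t else x j.

Fixpoint Ck (n k : nat) (U : (nat -> R) -> Prop) (h : (nat -> R) -> R) : Prop :=
  match k with
  | O => cont_on n U h
  | S k' => cont_on n U h /\
      forall i, (i < n)%nat -> exists dh : (nat -> R) -> R,
        (forall x, U x -> derivable_pt_lim (fun t => h (upd x i t)) (x i) (dh x))
        /\ Ck n k' U dh
  end.

Definition smooth_on (n : nat) (U : (nat -> R) -> Prop) (h : (nat -> R) -> R) : Prop :=
  forall k, Ck n k U h.

Definition smooth_map_on (n : nat) (U : (nat -> R) -> Prop)
  (f : (nat -> R) -> (nat -> R)) : Prop :=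
  forall i, (i < n)%nat -> smooth_on n U (fun x => f x i).

(* f, defined (and smooth) on the open domain D of R^n, restricts to a local
   diffeomorphism from the subset M of D into the subset N of R^n.
   When M, N are embedded submanifolds (here: open sets, or a level set
   intersected with an open set, and a hyperplane), "smooth" for the local
   inverse means: restriction of a smooth map on an open set of R^n. *)
Definition local_diffeo_between (n : nat) (D M N : (nat -> R) -> Prop)
  (f : (nat -> R) -> (nat -> R)) : Prop :=
  forall x, M x ->
    exists (U W : (nat -> R) -> Prop) (g : (nat -> R) -> (nat -> R)),
      open_n n U /\ U x /\ (forall y, U y -> D y) /\
      open_n n W /\ W (f x) /\
      smooth_map_on n U f /\ smooth_map_on n W g /\
      (forall y, U y -> M y -> W (f y) /\ N (f y) /\ eqn n (g (f y)) y) /\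
      (forall z, W z -> N z -> U (g z) /\ M (g z) /\ eqn n (f (g z)) z).

Fixpoint sumn (n : nat) (x : nat -> R) : R :=
  match n with O => 0 | S m => sumn m x + x m end.

Fixpoint prodn (n : nat) (x : nat -> R) : R :=
  match n with O => 1 | S m => prodn m x * x m end.

Definition scale (c : R) (r : nat -> R) : nat -> R := fun i => c * r i.

(* Triangulated closed surfaces.  Vertices are 0..n-1 (the paper's     *)
(* 1..|V| shifted by one); F is the list of triangles.                 *)

Definition tri := (nat * nat * nat)%type.

Definition in_tri (t : tri) (v : nat) : Prop :=
  let '(a, b, c) := t in v = a \/ v = b \/ v = c.

Definition in_trib (t : tri) (v : nat) : bool :=
  let '(a, b, c) := t in (Nat.eqb v a || Nat.eqb v b || Nat.eqb v c)%bool.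

Definition is_edge (F : list tri) (i j : nat) : Prop :=
  i <> j /\ exists t, In t F /\ in_tri t i /\ in_tri t j.

Definition link_adj (F : list tri) (v u w : nat) : Prop :=
  exists t, In t F /\ in_tri t v /\ in_tri t u /\ in_tri t w /\
            v <> u /\ v <> w /\ u <> w.

Definition closed_tri_surface (n : nat) (F : list tri) : Prop :=
  (forall a b c, In (a, b, c) F ->
     (a < n)%nat /\ (b < n)%nat /\ (c < n)%nat /\ a <> b /\ b <> c /\ a <> c) /\
  (forall k1 k2 t0, (k1 < length F)%nat -> (k2 < length F)%nat ->
     (forall v, in_tri (nth k1 F t0) v <-> in_tri (nth k2 F t0) v) -> k1 = k2) /\
  (forall v, (v < n)%nat -> exists t, In t F /\ in_tri t v) /\
  (forall i j, is_edge F i j ->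
     length (filter (fun t => (in_trib t i && in_trib t j)%bool) F) = 2%nat) /\
  (* the link of every vertex is connected (hence a single circle) *)
  (forall v u w, is_edge F v u -> is_edge F v w ->
     clos_refl_trans nat (link_adj F v) u w) /\
  (forall i j, (i < n)%nat -> (j < n)%nat ->
     clos_refl_trans nat (is_edge F) i j).

Definition lenE (I : nat -> nat -> R) (r : nat -> R) (i j : nat) : R :=
  sqrt (r i ^ 2 + r j ^ 2 + 2 * r i * r j * I i j).

Definition arcosh (x : R) : R := ln (x + sqrt (x ^ 2 - 1)).

Definition lenH (I : nat -> nat -> R) (r : nat -> R) (i j : nat) : R :=
  arcosh (cosh (r i) * cosh (r j) + I i j * sinh (r i) * sinh (r j)).

Definition admissible (n : nat) (F : list tri) (len : nat -> nat -> R)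
  (r : nat -> R) : Prop :=
  (forall i, (i < n)%nat -> 0 < r i) /\
  (forall a b c, In (a, b, c) F ->
     len a b < len b c + len c a /\
     len b c < len c a + len a b /\
     len c a < len a b + len b c).

Definition admE (n : nat) (F : list tri) (I : nat -> nat -> R) (r : nat -> R) :=
  admissible n F (lenE I r) r.

Definition admH (n : nat) (F : list tri) (I : nat -> nat -> R) (r : nat -> R) :=
  admissible n F (lenH I r) r.

Definition angE (x y z : R) : R := acos ((x ^ 2 + y ^ 2 - z ^ 2) / (2 * x * y)).
Definition angH (x y z : R) : R :=
  acos ((cosh x * cosh y - cosh z) / (sinh x * sinh y)).

Definition angle_at (ang : R -> R -> R -> R) (len : nat -> nat -> R)
  (t : tri) (i : nat) : R :=
  let '(a, b, c) := t in
  if Nat.eqb i a then ang (len a b) (len a c) (len b c)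
  else if Nat.eqb i b then ang (len b a) (len b c) (len a c)
  else if Nat.eqb i c then ang (len c a) (len c b) (len a b)
  else 0.

Definition cone_angle (F : list tri) (ang : R -> R -> R -> R)
  (len : nat -> nat -> R) (i : nat) : R :=
  fold_right (fun t s => angle_at ang len t i + s) 0 F.

Definition coneE (F : list tri) (I : nat -> nat -> R) (r : nat -> R) : nat -> R :=
  fun i => cone_angle F angE (lenE I r) i.

Definition coneH (F : list tri) (I : nat -> nat -> R) (r : nat -> R) : nat -> R :=
  fun i => cone_angle F angH (lenH I r) i.

(* Main.v *)
From Coquelicot Require Import Coquelicot.
Require Import Defs.
From Stdlib Require Import Reals List Lra Lia Nsatz.
From Stdlib Require Import FunctionalExtensionality ClassicalEpsilon IndefiniteDescription.
Open Scope R_scope.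

(* The Euclidean and the hyperbolic plane are treated together, as planes of curvature [- curv T]
   with [curv T >= 0]. In the coordinates [u] with [du_i = dr_i / sn r_i], and up to a negative
   factor, the Jacobian of the three angles of a triangle is a symmetric matrix. Since the
   inversive distances are nonnegative, at most one of its principal 2x2 minors fails to be
   positive; since at most one angle of a triangle is obtuse, one of the diagonal entries is
   positive, and by the minors all of them are. The determinant is [curv T] times a positive number.
   Hence the matrix is positive definite in the hyperbolic plane and positive semidefinite in the
   Euclidean plane, where its kernel is spanned by the scaling direction (1,1,1). Summing over the
   triangles of a connected surface gives the same for the Jacobian of the cone angles. In the
   Euclidean case, subtracting the sum of the [ln r_i] from every cone angle makes this Jacobian
   definite, and does not change the cone angles where the product of the radii is 1. The inverse
   function theorem does the rest; it is derived from the contraction principle, with the smooth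
   inverse of the Jacobian obtained from Schur complements. *)

Local Notation vec := (nat -> R).

(** * Finite sums *)

Lemma sumn_ext n f g : (forall i, (i < n)%nat -> f i = g i) -> sumn n f = sumn n g.
Proof.
  induction n as [|n IH]; intros H; simpl; [reflexivity|].
  rewrite IH by (intros; apply H; lia). rewrite H by lia. reflexivity.
Qed.

Lemma sumn_plus n f g : sumn n (fun i => f i + g i) = sumn n f + sumn n g.
Proof. induction n as [|n IH]; simpl; [ring|rewrite IH; ring]. Qed.

Lemma sumn_scal n c f : sumn n (fun i => c * f i) = c * sumn n f.
Proof. induction n as [|n IH]; simpl; [ring|rewrite IH; ring]. Qed.

Lemma sumn_minus n f g : sumn n (fun i => f i - g i) = sumn n f - sumn n g.
Proof. induction n as [|n IH]; simpl; [ring|rewrite IH; ring]. Qed.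

Lemma sumn_const n c : sumn n (fun _ => c) = INR n * c.
Proof. induction n as [|n IH]; [simpl; ring|]. rewrite S_INR; simpl; rewrite IH; ring. Qed.

Lemma sumn_zero n f : (forall i, (i < n)%nat -> f i = 0) -> sumn n f = 0.
Proof. intros H. rewrite (sumn_ext n f (fun _ => 0)), sumn_const by auto. ring. Qed.

Lemma sumn_swap n m f :
  sumn n (fun i => sumn m (fun j => f i j)) = sumn m (fun j => sumn n (fun i => f i j)).
Proof.
  induction n as [|n IH]; simpl.
  - symmetry. now apply sumn_zero.
  - rewrite IH, <- sumn_plus. reflexivity.
Qed.

Lemma sumn_le n f g : (forall i, (i < n)%nat -> f i <= g i) -> sumn n f <= sumn n g.
Proof.
  induction n as [|n IH]; intros H; simpl; [lra|].
  apply Rplus_le_compat; [apply IH; intros; apply H; lia | apply H; lia].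
Qed.

Lemma sumn_nonneg n f : (forall i, (i < n)%nat -> 0 <= f i) -> 0 <= sumn n f.
Proof.
  intros H. rewrite <- (sumn_zero n (fun _ => 0)) by auto. now apply sumn_le.
Qed.

Lemma sumn_abs n f : Rabs (sumn n f) <= sumn n (fun i => Rabs (f i)).
Proof.
  induction n as [|n IH]; simpl; [rewrite Rabs_R0; lra|].
  eapply Rle_trans; [apply Rabs_triang|]. lra.
Qed.

Lemma sumn_term_le n f k :
  (forall i, (i < n)%nat -> 0 <= f i) -> (k < n)%nat -> f k <= sumn n f.
Proof.
  induction n as [|n IH]; intros H Hk; [lia|]; simpl.
  pose proof (H n ltac:(lia)).
  assert (0 <= sumn n f) by (apply sumn_nonneg; intros; apply H; lia).
  destruct (Nat.eq_dec k n) as [->|]; [lra|].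
  assert (f k <= sumn n f) by (apply IH; [intros; apply H|]; lia). lra.
Qed.

Definition kron (i j : nat) : R := if Nat.eqb i j then 1 else 0.

Lemma kron_refl i : kron i i = 1.
Proof. unfold kron. now rewrite Nat.eqb_refl. Qed.

Lemma kron_neq i j : i <> j -> kron i j = 0.
Proof. unfold kron. intros H. apply Nat.eqb_neq in H. now rewrite H. Qed.

Lemma kron_sym i j : kron i j = kron j i.
Proof. unfold kron. now rewrite Nat.eqb_sym. Qed.

Lemma sumn_kron n k f : (k < n)%nat -> sumn n (fun i => kron k i * f i) = f k.
Proof.
  induction n as [|n IH]; intros Hk; [lia|]; simpl.
  destruct (Nat.eq_dec k n) as [->|].
  - rewrite sumn_zero by (intros; rewrite kron_neq by lia; ring). rewrite kron_refl. ring.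
  - rewrite IH, kron_neq by lia. ring.
Qed.

(** * Neighbourhoods and continuity *)

Lemma filter_forall_lt {A : Type} (F : (A -> Prop) -> Prop) {FF : Filter F} (n : nat)
  (P : nat -> A -> Prop) :
  (forall i, (i < n)%nat -> F (P i)) -> F (fun x => forall i, (i < n)%nat -> P i x).
Proof.
  induction n as [|n IH]; intros H.
  - apply filter_forall. intros; lia.
  - apply (filter_imp (fun x => (forall i, (i < n)%nat -> P i x) /\ P n x)).
    + intros x [Hlt Hn] i Hi. destruct (Nat.eq_dec i n) as [->|]; [assumption|apply Hlt; lia].
    + apply filter_and; [apply IH; intros|]; apply H; lia.
Qed.

Definition nbhds (n : nat) (x : vec) (P : vec -> Prop) : Prop :=
  exists d, 0 < d /\ forall y, ball n x d y -> P y.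

Lemma ball_refl n x e : 0 < e -> ball n x e x.
Proof. intros He i _. now rewrite Rminus_diag, Rabs_R0. Qed.

Lemma ball_le n x d e y : d <= e -> ball n x d y -> ball n x e y.
Proof. intros Hde H i Hi. specialize (H i Hi). lra. Qed.

Lemma ball_between n x0 r x y w :
  ball n x0 r x -> ball n x0 r y ->
  (forall i, (i < n)%nat -> Rmin (x i) (y i) <= w i <= Rmax (x i) (y i)) -> ball n x0 r w.
Proof.
  intros Hx Hy Hw i Hi. specialize (Hx i Hi). specialize (Hy i Hi). specialize (Hw i Hi).
  apply Rabs_def2 in Hx. apply Rabs_def2 in Hy. apply Rabs_def1;
  unfold Rmin, Rmax in Hw; destruct (Rle_dec (x i) (y i)); lra.
Qed.

Global Instance nbhds_filter n x : Filter (nbhds n x).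
Proof.
  split.
  - exists 1. split; [lra|auto].
  - intros P Q [d [Hd HP]] [e [He HQ]]. exists (Rmin d e). split; [now apply Rmin_pos|].
    intros y Hy. split.
    + apply HP. now apply ball_le with (2 := Hy), Rmin_l.
    + apply HQ. now apply ball_le with (2 := Hy), Rmin_r.
  - intros P Q HPQ [d [Hd HP]]. exists d. auto.
Qed.

Lemma nbhds_point n x P : nbhds n x P -> P x.
Proof. intros [d [Hd H]]. now apply H, ball_refl. Qed.

Lemma nbhds_ball n x r : 0 < r -> nbhds n x (ball n x r).
Proof. intros Hr. exists r. auto. Qed.

Lemma upd_same x i t : upd x i t i = t.
Proof. unfold upd. now rewrite Nat.eqb_refl. Qed.

Lemma upd_other x i j t : j <> i -> upd x i t j = x j.
Proof. unfold upd. intros H. apply Nat.eqb_neq in H. now rewrite H. Qed.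

Lemma upd_id x i : upd x i (x i) = x.
Proof. extensionality j. unfold upd. destruct (Nat.eqb_spec j i); now subst. Qed.

Lemma upd_upd x i s t : upd (upd x i s) i t = upd x i t.
Proof. extensionality j. unfold upd. now destruct (Nat.eqb j i). Qed.

Lemma nbhds_upd n x i (P : vec -> Prop) :
  nbhds n x P -> locally (x i) (fun t => P (upd x i t)).
Proof.
  intros [d [Hd H]]. exists (mkposreal d Hd). intros t Ht. apply H. intros j _.
  destruct (Nat.eq_dec j i) as [->|Hj].
  - rewrite upd_same. exact Ht.
  - now rewrite upd_other, Rminus_diag, Rabs_R0.
Qed.

Lemma open_n_and n U V : open_n n U -> open_n n V -> open_n n (fun x => U x /\ V x).
Proof. intros HU HV x [Ux Vx]. exact (filter_and (F := nbhds n x) _ _ (HU x Ux) (HV x Vx)). Qed.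

Lemma open_n_ext n (U V : vec -> Prop) : (forall x, U x <-> V x) -> open_n n U -> open_n n V.
Proof.
  intros E HU x Hx. apply (filter_imp (F := nbhds n x) U); [apply E|]. now apply HU, E.
Qed.

Lemma open_n_ball n x r : open_n n (ball n x r).
Proof.
  intros y Hy. apply (filter_forall_lt (nbhds n y)). intros i Hi.
  exists (r - Rabs (y i - x i)). specialize (Hy i Hi). split; [lra|].
  intros z Hz. specialize (Hz i Hi). replace (z i - x i) with ((z i - y i) + (y i - x i)) by ring.
  eapply Rle_lt_trans; [apply Rabs_triang|]. lra.
Qed.

Lemma cont_on_filterlim n U h :
  cont_on n U h <-> forall x, U x -> filterlim h (within U (nbhds n x)) (locally (h x)).
Proof.
  split; intros H x Hx.
  - apply filterlim_locally. intros e. destruct (H x Hx e (cond_pos e)) as [d [Hd Hb]].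
    exists d. split; [assumption|]. intros y Hy Uy. now apply Hb.
  - intros e He. destruct (proj1 (filterlim_locally _ _) (H x Hx) (mkposreal e He))
      as [d [Hd Hb]].
    exists d. split; [assumption|]. intros y Uy Hy. now apply Hb.
Qed.

Lemma cont_on_eqn n U h x y : cont_on n U h -> U x -> U y -> eqn n x y -> h y = h x.
Proof.
  intros Hh Hx Hy E. apply cond_eq. intros e He. destruct (Hh x Hx e He) as [d [Hd Hb]].
  apply Hb; [assumption|]. intros i Hi. now rewrite (E i Hi), Rminus_diag, Rabs_R0.
Qed.

Lemma cont_on_ext n U h h' :
  (forall x, U x -> h x = h' x) -> cont_on n U h -> cont_on n U h'.
Proof.
  intros E H x Hx e He. destruct (H x Hx e He) as [d [Hd Hb]].
  exists d. split; [assumption|]. intros y Hy By. rewrite <- !E; auto.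
Qed.

Lemma cont_on_sub n U U' h : (forall x, U' x -> U x) -> cont_on n U h -> cont_on n U' h.
Proof.
  intros Hs H x Hx e He. destruct (H x (Hs x Hx) e He) as [d [Hd Hb]]. exists d; auto.
Qed.

Lemma cont_on_const n U c : cont_on n U (fun _ => c).
Proof. apply cont_on_filterlim. intros x _. apply filterlim_const. Qed.

Lemma cont_on_proj n U i : (i < n)%nat -> cont_on n U (fun x => x i).
Proof. intros Hi x _ e He. exists e. auto. Qed.

Lemma cont_on_plus n U f g :
  cont_on n U f -> cont_on n U g -> cont_on n U (fun x => f x + g x).
Proof.
  rewrite !cont_on_filterlim. intros Hf Hg x Hx.
  exact (filterlim_comp_2 _ _ Rplus (Hf x Hx) (Hg x Hx) (filterlim_plus (f x) (g x))).
Qed.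

Lemma cont_on_mult n U f g :
  cont_on n U f -> cont_on n U g -> cont_on n U (fun x => f x * g x).
Proof.
  rewrite !cont_on_filterlim. intros Hf Hg x Hx.
  exact (filterlim_comp_2 _ _ Rmult (Hf x Hx) (Hg x Hx) (filterlim_mult (f x) (g x))).
Qed.

Lemma nbhds_preimage n U m (g : nat -> vec -> R) x P :
  (forall i, (i < m)%nat -> cont_on n U (g i)) -> U x -> nbhds m (fun i => g i x) P ->
  within U (nbhds n x) (fun y => P (fun i => g i y)).
Proof.
  intros Hg Hx [e [He HP]].
  apply (filter_imp (F := within U (nbhds n x))
    (fun y => forall i, (i < m)%nat -> Rabs (g i y - g i x) < e)); [intros y; apply HP|].
  apply (filter_forall_lt (within U (nbhds n x))). intros i Hi.
  destruct (Hg i Hi x Hx e He) as [d [Hd Hb]]. exists d. split; [assumption|].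
  intros y Hy Uy. now apply Hb.
Qed.

Lemma open_n_preimage n U m V (g : nat -> vec -> R) :
  open_n n U -> open_n m V -> (forall i, (i < m)%nat -> cont_on n U (g i)) ->
  open_n n (fun x => U x /\ V (fun i => g i x)).
Proof.
  intros HU HV Hg x [Ux Vx].
  apply (filter_imp (F := nbhds n x) (fun y => U y /\ (U y -> V (fun i => g i y)))); [tauto|].
  apply (filter_and (F := nbhds n x)); [now apply HU|].
  exact (nbhds_preimage n U m g x V Hg Ux (HV _ Vx)).
Qed.

Lemma open_n_lt n U f g :
  open_n n U -> cont_on n U f -> cont_on n U g -> open_n n (fun x => U x /\ f x < g x).
Proof.
  intros HU Hf Hg x [Ux Hx].
  apply (filter_imp (F := nbhds n x) (fun y => U y /\ (U y -> f y < g y))); [tauto|].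
  apply (filter_and (F := nbhds n x)); [now apply HU|].
  assert (He : 0 < (g x - f x) / 2) by lra.
  destruct (Hf x Ux _ He) as [df [Hdf Hbf]]. destruct (Hg x Ux _ He) as [dg [Hdg Hbg]].
  generalize (filter_and (F := nbhds n x) _ _ (nbhds_ball n x df Hdf) (nbhds_ball n x dg Hdg)).
  apply filter_imp. intros y [Byf Byg] Uy.
  pose proof (Rabs_def2 _ _ (Hbf y Uy Byf)). pose proof (Rabs_def2 _ _ (Hbg y Uy Byg)). lra.
Qed.

Lemma cont_on_comp n U m V h (g : nat -> vec -> R) :
  cont_on m V h -> (forall i, (i < m)%nat -> cont_on n U (g i)) ->
  (forall x, U x -> V (fun i => g i x)) -> cont_on n U (fun x => h (fun i => g i x)).
Proof.
  rewrite (cont_on_filterlim m V h). intros Hh Hg HUV. apply cont_on_filterlim.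
  intros x Hx P HP. specialize (Hh _ (HUV x Hx) P HP).
  generalize (nbhds_preimage n U m g x _ Hg Hx Hh). apply (filter_imp (F := nbhds n x)).
  intros y Hy Uy. apply Hy; auto.
Qed.

(** * Derivatives *)

Lemma is_derive_Rplus (f g : R -> R) (t df dg : R) :
  is_derive f t df -> is_derive g t dg -> is_derive (fun s => f s + g s) t (df + dg).
Proof. apply (is_derive_plus (K := R_AbsRing) (V := R_NormedModule)). Qed.

Lemma is_derive_Rminus (f g : R -> R) (t df dg : R) :
  is_derive f t df -> is_derive g t dg -> is_derive (fun s => f s - g s) t (df - dg).
Proof. apply (is_derive_minus (K := R_AbsRing) (V := R_NormedModule)). Qed.

Lemma is_derive_Rmult (f g : R -> R) (t df dg : R) :
  is_derive f t df -> is_derive g t dg ->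
  is_derive (fun s => f s * g s) t (df * g t + f t * dg).
Proof. intros Hf Hg. apply (is_derive_mult f g t df dg Hf Hg). exact Rmult_comm. Qed.

Lemma is_derive_Rcomp (f g : R -> R) (t df dg : R) :
  is_derive f (g t) df -> is_derive g t dg -> is_derive (fun s => f (g s)) t (df * dg).
Proof.
  intros Hf Hg. rewrite Rmult_comm. exact (is_derive_comp f g t df dg Hf Hg).
Qed.

Lemma is_derive_Rconst (c t : R) : is_derive (fun _ => c) t 0.
Proof. exact (is_derive_const c t). Qed.

Lemma is_derive_eq (f : R -> R) (t l l' : R) : is_derive f t l -> l = l' -> is_derive f t l'.
Proof. now intros H <-. Qed.

(** * Functions of class C^k *)

Definition partial (j : nat) (h : vec -> R) (x : vec) : R :=
  Derive (fun t => h (upd x j t)) (x j).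

Lemma partial_unique j h x l : is_derive (fun t => h (upd x j t)) (x j) l -> partial j h x = l.
Proof. apply is_derive_unique. Qed.

Lemma Ck_cont n k U h : Ck n k U h -> cont_on n U h.
Proof. destruct k; simpl; tauto. Qed.

Lemma Ck_succ n k U h (dh : nat -> vec -> R) :
  cont_on n U h ->
  (forall j x, (j < n)%nat -> U x -> is_derive (fun t => h (upd x j t)) (x j) (dh j x)) ->
  (forall j, (j < n)%nat -> Ck n k U (dh j)) -> Ck n (S k) U h.
Proof.
  intros Hc Hd Hk. split; [assumption|]. intros j Hj. exists (dh j). split; [|auto].
  intros x Hx. apply is_derive_Reals. auto.
Qed.

Lemma is_derive_upd_ext n U j (g h : vec -> R) x l :
  open_n n U -> U x -> (forall y, U y -> g y = h y) ->
  is_derive (fun t => g (upd x j t)) (x j) l -> is_derive (fun t => h (upd x j t)) (x j) l.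
Proof.
  intros HU Hx E. apply is_derive_ext_loc.
  generalize (nbhds_upd n x j U (HU x Hx)). apply filter_imp. auto.
Qed.

Lemma Ck_ext n k U g h : open_n n U -> (forall x, U x -> g x = h x) -> Ck n k U g -> Ck n k U h.
Proof.
  intros HU E. destruct k as [|k]; simpl.
  - now apply cont_on_ext.
  - intros [Hc Hd]. split; [now apply cont_on_ext with g|]. intros j Hj.
    destruct (Hd j Hj) as [dg [Hdg Hk]]. exists dg. split; [|assumption]. intros x Hx.
    apply is_derive_Reals, (is_derive_upd_ext n U j g); auto. now apply is_derive_Reals, Hdg.
Qed.

Lemma Ck_sub n k U U' h : (forall x, U' x -> U x) -> Ck n k U h -> Ck n k U' h.
Proof.
  intros Hs. revert h. induction k as [|k IH]; simpl; intros h.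
  - now apply cont_on_sub.
  - intros [Hc Hd]. split; [now apply cont_on_sub with U|]. intros j Hj.
    destruct (Hd j Hj) as [dh [Hdh Hk]]. exists dh. auto.
Qed.

Lemma Ck_pred n k U h : Ck n (S k) U h -> Ck n k U h.
Proof.
  revert h. induction k as [|k IH]; intros h H.
  - now apply Ck_cont in H.
  - destruct H as [Hc Hd]. split; [assumption|]. intros j Hj.
    destruct (Hd j Hj) as [dh [Hdh Hk]]. exists dh. auto.
Qed.

Lemma Ck_is_derive n k U h j x :
  Ck n (S k) U h -> (j < n)%nat -> U x ->
  is_derive (fun t => h (upd x j t)) (x j) (partial j h x).
Proof.
  intros [_ Hd] Hj Hx. destruct (Hd j Hj) as [dh [Hdh _]].
  apply Derive_correct. exists (dh x). now apply is_derive_Reals, Hdh.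
Qed.

Lemma Ck_partial n k U h j :
  open_n n U -> Ck n (S k) U h -> (j < n)%nat -> Ck n k U (partial j h).
Proof.
  intros HU [_ Hd] Hj. destruct (Hd j Hj) as [dh [Hdh Hk]].
  apply Ck_ext with dh; [assumption| |assumption]. intros x Hx.
  symmetry. now apply partial_unique, is_derive_Reals, Hdh.
Qed.

Lemma Ck_const n k U c : Ck n k U (fun _ => c).
Proof.
  revert c. induction k as [|k IH]; intros c; [apply cont_on_const|].
  apply Ck_succ with (fun _ _ => 0); auto using cont_on_const.
  intros. apply (is_derive_const c).
Qed.

Lemma is_derive_upd x i j : is_derive (fun t => upd x j t i) (x j) (kron i j).
Proof.
  destruct (Nat.eq_dec i j) as [->|Hn].
  - rewrite kron_refl. apply is_derive_ext with (fun t => t); [|apply (is_derive_id (x j))].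
    intros; now rewrite upd_same.
  - rewrite kron_neq by assumption. apply is_derive_ext with (fun _ => x i);
      [|apply (is_derive_const (x i))].
    intros; now rewrite upd_other.
Qed.

Lemma Ck_proj n k U i : (i < n)%nat -> Ck n k U (fun x => x i).
Proof.
  intros Hi. destruct k as [|k]; [now apply cont_on_proj|].
  apply Ck_succ with (fun j _ => kron i j); auto using cont_on_proj, Ck_const.
  intros. apply is_derive_upd.
Qed.

Lemma Ck_plus n k U f g : Ck n k U f -> Ck n k U g -> Ck n k U (fun x => f x + g x).
Proof.
  revert f g. induction k as [|k IH]; intros f g.
  - apply cont_on_plus.
  - intros [Cf Df] [Cg Dg]. split; [now apply cont_on_plus|]. intros j Hj.
    destruct (Df j Hj) as [df [Hf Kf]]. destruct (Dg j Hj) as [dg [Hg Kg]].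
    exists (fun x => df x + dg x). split; [|auto]. intros x Hx.
    apply (derivable_pt_lim_plus (fun t => f (upd x j t)) (fun t => g (upd x j t))); auto.
Qed.

Lemma Ck_mult n k U f g : Ck n k U f -> Ck n k U g -> Ck n k U (fun x => f x * g x).
Proof.
  revert f g. induction k as [|k IH]; intros f g; [apply cont_on_mult|].
  intros Hf Hg. pose proof (Ck_pred _ _ _ _ Hf). pose proof (Ck_pred _ _ _ _ Hg).
  destruct Hf as [Cf Df]. destruct Hg as [Cg Dg].
  split; [now apply cont_on_mult|]. intros j Hj.
  destruct (Df j Hj) as [df [Hf Kf]]. destruct (Dg j Hj) as [dg [Hg Kg]].
  exists (fun x => df x * g x + f x * dg x). split.
  - intros x Hx. pose proof (derivable_pt_lim_mult (fun t => f (upd x j t)) (fun t => g (upd x j t))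
      (x j) (df x) (dg x) (Hf x Hx) (Hg x Hx)) as P.
    cbv beta in P. rewrite upd_id in P. exact P.
  - apply Ck_plus; apply IH; assumption.
Qed.

Lemma Ck_minus n k U f g : Ck n k U f -> Ck n k U g -> Ck n k U (fun x => f x - g x).
Proof.
  intros Hf Hg. replace (fun x => f x - g x) with (fun x => f x + -1 * g x)
    by (extensionality x; ring).
  apply Ck_plus; [assumption|]. apply Ck_mult; [apply Ck_const|assumption].
Qed.

Lemma Ck_sumn n k U m (f : nat -> vec -> R) :
  (forall i, (i < m)%nat -> Ck n k U (f i)) -> Ck n k U (fun x => sumn m (fun i => f i x)).
Proof.
  induction m as [|m IH]; intros H; simpl; [apply Ck_const|].
  apply (Ck_plus n k U (fun x => sumn m (fun i => f i x)) (f m)); [apply IH; intros|]; apply H; lia.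
Qed.

(** * Strict differentiability and the chain rule *)

Fixpoint supnorm (n : nat) (v : vec) : R :=
  match n with O => 0 | S m => Rmax (supnorm m v) (Rabs (v m)) end.

Definition supdist (n : nat) (x y : vec) : R := supnorm n (fun i => y i - x i).

Lemma supnorm_ge n v i : (i < n)%nat -> Rabs (v i) <= supnorm n v.
Proof.
  induction n as [|n IH]; intros Hi; [lia|]. simpl.
  destruct (Nat.eq_dec i n) as [->|]; [apply Rmax_r|].
  eapply Rle_trans; [apply IH; lia|apply Rmax_l].
Qed.

Lemma supnorm_le n v M : 0 <= M -> (forall i, (i < n)%nat -> Rabs (v i) <= M) -> supnorm n v <= M.
Proof.
  induction n as [|n IH]; intros HM H; simpl; [assumption|].
  apply Rmax_lub; [apply IH; auto|apply H; lia].
Qed.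

Lemma supnorm_nonneg n v : 0 <= supnorm n v.
Proof.
  destruct n as [|n]; simpl; [lra|]. eapply Rle_trans; [apply (Rabs_pos (v n))|apply Rmax_r].
Qed.

Lemma sumn_abs_supnorm n v : sumn n (fun i => Rabs (v i)) <= INR n * supnorm n v.
Proof. rewrite <- sumn_const. apply sumn_le. intros. now apply supnorm_ge. Qed.

Lemma supnorm_ext n v w : eqn n v w -> supnorm n v = supnorm n w.
Proof.
  intros E. apply Rle_antisym; apply supnorm_le; try apply supnorm_nonneg; intros i Hi;
    [rewrite (E i Hi)|rewrite <- (E i Hi)]; now apply supnorm_ge.
Qed.

Lemma supdist_ge n x y i : (i < n)%nat -> Rabs (y i - x i) <= supdist n x y.
Proof. apply (supnorm_ge n (fun i => y i - x i) i). Qed.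

Lemma supdist_refl n x : supdist n x x = 0.
Proof.
  apply Rle_antisym; [|apply supnorm_nonneg]. apply supnorm_le; [lra|].
  intros. rewrite Rminus_diag, Rabs_R0. lra.
Qed.

Lemma supdist_sym n x y : supdist n x y = supdist n y x.
Proof.
  apply Rle_antisym; (apply supnorm_le; [apply supnorm_nonneg|]; intros i Hi;
    rewrite Rabs_minus_sym; now apply supdist_ge).
Qed.

Lemma supdist_triangle n x y z : supdist n x z <= supdist n x y + supdist n y z.
Proof.
  apply supnorm_le.
  - pose proof (supnorm_nonneg n (fun i => y i - x i)).
    pose proof (supnorm_nonneg n (fun i => z i - y i)). unfold supdist. lra.
  - intros i Hi. replace (z i - x i) with ((y i - x i) + (z i - y i)) by ring.
    eapply Rle_trans; [apply Rabs_triang|].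
    apply Rplus_le_compat; now apply supdist_ge.
Qed.

Lemma eqn_of_supdist n x y : supdist n x y <= 0 -> eqn n y x.
Proof.
  intros H i Hi. apply Rminus_diag_uniq, Rabs_eq_0, Rle_antisym; [|apply Rabs_pos].
  apply Rle_trans with (2 := H). now apply supdist_ge.
Qed.

Lemma ball_of_supdist n x r y : supdist n x y < r -> ball n x r y.
Proof. intros H i Hi. apply Rle_lt_trans with (2 := H). now apply supdist_ge. Qed.

Lemma supdist_lt_of_ball n x r y : 0 < r -> ball n x r y -> supdist n x y < r.
Proof.
  intros Hr. unfold supdist. induction n as [|n IH]; intros H; simpl; [assumption|].
  apply Rmax_lub_lt; [apply IH; intros i Hi|]; apply H; lia.
Qed.

Lemma coordinate_mean_value n x0 r h (dh : vec -> R) k x t c e :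
  (k < n)%nat -> ball n x0 r x -> ball n x0 r (upd x k t) ->
  (forall w, ball n x0 r w ->
     is_derive (fun s => h (upd w k s)) (w k) (dh w) /\ Rabs (dh w - c) <= e) ->
  Rabs (h (upd x k t) - h x - c * (t - x k)) <= e * Rabs (t - x k).
Proof.
  intros Hk Hx Ht H.
  assert (Hseg : forall s, Rmin (x k) t <= s <= Rmax (x k) t -> ball n x0 r (upd x k s)).
  { intros s Hs. apply (ball_between n x0 r x (upd x k t)); try assumption. intros i _.
    destruct (Nat.eq_dec i k) as [->|Hn].
    - now rewrite !upd_same.
    - rewrite !upd_other by assumption. unfold Rmin, Rmax. destruct (Rle_dec _ _); lra. }
  assert (Hder : forall s, Rmin (x k) t <= s <= Rmax (x k) t ->
    is_derive (fun s => h (upd x k s)) s (dh (upd x k s))).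
  { intros s Hs. destruct (H _ (Hseg s Hs)) as [D _]. rewrite upd_same in D.
    apply (is_derive_ext (fun u => h (upd (upd x k s) k u))); [|assumption].
    intros u. now rewrite upd_upd. }
  destruct (MVT_gen (fun s => h (upd x k s)) (x k) t (fun s => dh (upd x k s))) as [s [Hs E]].
  - intros s Hs. apply Hder. lra.
  - intros s Hs. apply continuity_pt_filterlim, (ex_derive_continuous (fun s => h (upd x k s))).
    eexists. now apply Hder.
  - rewrite upd_id in E. rewrite E.
    replace (dh (upd x k s) * (t - x k) - c * (t - x k)) with ((dh (upd x k s) - c) * (t - x k))
      by ring.
    rewrite Rabs_mult. apply Rmult_le_compat_r; [apply Rabs_pos|]. now apply H, Hseg.
Qed.

(* The coordinates of [x] are moved to those of [y] one at a time, from the last to the first. *)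
Lemma ball_mean_value n x0 r h (dh : nat -> vec -> R) c e :
  cont_on n (ball n x0 r) h ->
  (forall j w, (j < n)%nat -> ball n x0 r w ->
     is_derive (fun t => h (upd w j t)) (w j) (dh j w) /\ Rabs (dh j w - c j) <= e) ->
  forall x y, ball n x0 r x -> ball n x0 r y ->
    Rabs (h y - h x - sumn n (fun j => c j * (y j - x j)))
      <= e * sumn n (fun j => Rabs (y j - x j)).
Proof.
  intros Hc H.
  assert (K : forall m, (m <= n)%nat -> forall x y, ball n x0 r x -> ball n x0 r y ->
    (forall i, (m <= i < n)%nat -> y i = x i) ->
    Rabs (h y - h x - sumn m (fun j => c j * (y j - x j)))
      <= e * sumn m (fun j => Rabs (y j - x j)));
    [|intros x y Hx Hy; apply K; auto; intros; lia].
  induction m as [|m IH]; intros Hm x y Hx Hy E; simpl.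
  - rewrite (cont_on_eqn n _ h x y Hc Hx Hy) by (intros i Hi; symmetry; apply E; lia).
    rewrite Rminus_diag, Rminus_0_r, Rabs_R0. lra.
  - set (w := upd x m (y m)).
    assert (Hw : ball n x0 r w).
    { apply (ball_between n x0 r x y); try assumption. intros i Hi. unfold w.
      destruct (Nat.eq_dec i m) as [->|Hn]; [rewrite upd_same|rewrite upd_other by assumption];
        auto using Rmin_l, Rmin_r, Rmax_l, Rmax_r. }
    assert (Hstep : Rabs (h w - h x - c m * (y m - x m)) <= e * Rabs (y m - x m)).
    { apply (coordinate_mean_value n x0 r h (dh m)); auto. }
    assert (Hrest : Rabs (h y - h w - sumn m (fun j => c j * (y j - w j)))
      <= e * sumn m (fun j => Rabs (y j - w j))).
    { apply IH; auto; [lia|]. intros i Hi. unfold w. destruct (Nat.eq_dec i m) as [->|Hn];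
        [now rewrite upd_same|rewrite upd_other by assumption; apply E; lia]. }
    rewrite (sumn_ext m (fun j => c j * (y j - w j)) (fun j => c j * (y j - x j))),
      (sumn_ext m (fun j => Rabs (y j - w j)) (fun j => Rabs (y j - x j))) in Hrest
      by (intros; unfold w; now rewrite upd_other by lia).
    replace (h y - h x - _) with ((h y - h w - sumn m (fun j => c j * (y j - x j)))
      + (h w - h x - c m * (y m - x m))) by ring.
    eapply Rle_trans; [apply Rabs_triang|]. lra.
Qed.

Lemma strictly_differentiable n U h x0 :
  open_n n U -> Ck n 1 U h -> U x0 -> forall e, 0 < e ->
  exists d, 0 < d /\ (forall x, ball n x0 d x -> U x) /\
    forall x y, ball n x0 d x -> ball n x0 d y ->
      Rabs (h y - h x - sumn n (fun j => partial j h x0 * (y j - x j))) <= e * supdist n x y.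
Proof.
  intros HU Hh Hx0 e He. pose proof (pos_INR n) as Hn.
  assert (He' : 0 < e / (INR n + 1)) by (apply Rdiv_lt_0_compat; lra).
  assert (Hnear : nbhds n x0 (fun w => U w /\ forall j, (j < n)%nat ->
    Rabs (partial j h w - partial j h x0) <= e / (INR n + 1))).
  { apply filter_and; [now apply HU|]. apply (filter_forall_lt (nbhds n x0)). intros j Hj.
    destruct (Ck_cont n 0 U _ (Ck_partial n 0 U h j HU Hh Hj) x0 Hx0 _ He') as [d [Hd Hb]].
    generalize (filter_and (F := nbhds n x0) _ _ (HU x0 Hx0) (nbhds_ball n x0 d Hd)).
    apply filter_imp. intros w [Uw Bw]. left. now apply Hb. }
  destruct Hnear as [d [Hd Hw]]. exists d. split; [assumption|]. split; [now intros; apply Hw|].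
  intros x y Hx Hy.
  eapply Rle_trans.
  - apply (ball_mean_value n x0 d h (fun j => partial j h) (fun j => partial j h x0)
      (e / (INR n + 1))); try assumption.
    + apply cont_on_sub with U; [now intros; apply Hw|]. now apply Ck_cont in Hh.
    + intros j w Hj Bw. destruct (Hw w Bw) as [Uw Hp].
      split; [now apply Ck_is_derive with n 0%nat U|auto].
  - assert (0 <= supdist n x y) by apply supnorm_nonneg.
    apply Rle_trans with (e / (INR n + 1) * ((INR n + 1) * supdist n x y)).
    + apply Rmult_le_compat_l; [lra|].
      eapply Rle_trans; [apply sumn_abs_supnorm|]. fold (supdist n x y). lra.
    + right. field. lra.
Qed.

Lemma is_derive_increment f (a l : R) :
  is_derive f a l <-> forall e, 0 < e ->
    locally a (fun t => Rabs (f t - f a - l * (t - a)) <= e * Rabs (t - a)).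
Proof.
  split.
  - intros [_ H] e He. generalize (H a (fun P HP => HP) (mkposreal e He)). apply filter_imp.
    intros t Ht. rewrite (Rmult_comm l). exact Ht.
  - intros H. split; [apply is_linear_scal_l|]. intros x Hx e.
    rewrite <- (is_filter_lim_locally_unique a x Hx).
    generalize (H e (cond_pos e)). apply filter_imp.
    intros t Ht. rewrite (Rmult_comm l) in Ht. exact Ht.
Qed.

Lemma is_derive_lipschitz f (a l : R) :
  is_derive f a l -> locally a (fun t => Rabs (f t - f a) <= (Rabs l + 1) * Rabs (t - a)).
Proof.
  intros H. generalize (proj1 (is_derive_increment f a l) H 1 Rlt_0_1). apply filter_imp.
  intros t Ht. replace (f t - f a) with ((f t - f a - l * (t - a)) + l * (t - a)) by ring.
  eapply Rle_trans; [apply Rabs_triang|]. rewrite Rabs_mult. lra.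
Qed.

Lemma is_derive_sumn m (f : nat -> R -> R) (l : vec) a :
  (forall i, (i < m)%nat -> is_derive (f i) a (l i)) ->
  is_derive (fun t => sumn m (fun i => f i t)) a (sumn m l).
Proof.
  induction m as [|m IH]; intros H; simpl; [apply (is_derive_const 0)|].
  apply (is_derive_Rplus (fun t => sumn m (fun i => f i t)) (f m)); [apply IH; intros|];
    apply H; lia.
Qed.

Lemma supdist_lipschitz m (G : nat -> R -> R) (g' : vec) a :
  (forall i, (i < m)%nat -> is_derive (G i) a (g' i)) ->
  exists K, 0 <= K /\ locally a (fun t =>
    supdist m (fun i => G i a) (fun i => G i t) <= K * Rabs (t - a)).
Proof.
  intros HG. exists (sumn m (fun i => Rabs (g' i) + 1)).
  assert (Hpos : forall i, (i < m)%nat -> 0 <= Rabs (g' i) + 1)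
    by (intros i _; pose proof (Rabs_pos (g' i)); lra).
  split; [now apply sumn_nonneg|].
  generalize (filter_forall_lt (locally a) m _ (fun i Hi => is_derive_lipschitz _ _ _ (HG i Hi))).
  apply filter_imp. intros t Ht. apply supnorm_le.
  - apply Rmult_le_pos; [now apply sumn_nonneg|apply Rabs_pos].
  - intros i Hi. eapply Rle_trans; [now apply Ht|]. apply Rmult_le_compat_r; [apply Rabs_pos|].
    now apply (sumn_term_le m (fun i => Rabs (g' i) + 1)).
Qed.

Lemma chain_rule m V h (G : nat -> R -> R) (g' : vec) a :
  open_n m V -> Ck m 1 V h -> V (fun i => G i a) ->
  (forall i, (i < m)%nat -> is_derive (G i) a (g' i)) ->
  is_derive (fun t => h (fun i => G i t)) a (sumn m (fun i => partial i h (fun i => G i a) * g' i)).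
Proof.
  intros HV Hh Ha HG. set (y0 := fun i => G i a) in *. set (c := fun i => partial i h y0).
  destruct (supdist_lipschitz m G g' a HG) as [K [HK HGK]].
  apply is_derive_increment. intros e He.
  assert (He' : 0 < e / 2 / (K + 1)) by (apply Rdiv_lt_0_compat; lra).
  destruct (strictly_differentiable m V h y0 HV Hh Ha _ He') as [d [Hd [_ Hdiff]]].
  assert (Hlin : locally a (fun t =>
    Rabs (sumn m (fun i => c i * G i t) - sumn m (fun i => c i * G i a)
          - sumn m (fun i => c i * g' i) * (t - a)) <= e / 2 * Rabs (t - a))).
  { apply (proj1 (is_derive_increment (fun t => sumn m (fun i => c i * G i t)) a _)); [|lra].
    apply (is_derive_sumn m (fun i t => c i * G i t)). intros i Hi.
    now apply (is_derive_scal (G i)), HG. }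
  assert (Hball : locally a (fun t => ball m y0 d (fun i => G i t))).
  { apply (filter_forall_lt (locally a)). intros i Hi.
    apply (proj1 (filterlim_locally (G i) (G i a))
      (ex_derive_continuous (G i) a (ex_intro _ _ (HG i Hi))) (mkposreal d Hd)). }
  generalize (filter_and _ _ HGK (filter_and _ _ Hlin Hball)). apply filter_imp.
  intros t [HKt [Hlt Hbt]].
  specialize (Hdiff y0 _ (ball_refl m y0 d Hd) Hbt).
  rewrite (sumn_ext m _ (fun i => c i * G i t - c i * G i a)), sumn_minus in Hdiff
    by (intros; unfold c, y0; ring).
  assert (Hsmall : e / 2 / (K + 1) * supdist m y0 (fun i => G i t) <= e / 2 * Rabs (t - a)).
  { apply Rle_trans with (e / 2 / (K + 1) * ((K + 1) * Rabs (t - a))).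
    - pose proof (Rabs_pos (t - a)). apply Rmult_le_compat_l; [lra|]. fold y0 in HKt. lra.
    - right. field. lra. }
  set (A := sumn m (fun i => c i * G i t)) in *. set (B := sumn m (fun i => c i * G i a)) in *.
  fold y0. set (l := sumn m (fun i => c i * g' i)) in *.
  change (sumn m (fun i => partial i h y0 * g' i)) with l.
  replace (h (fun i => G i t) - h y0 - l * (t - a))
    with ((h (fun i => G i t) - h y0 - (A - B)) + (A - B - l * (t - a))) by ring.
  eapply Rle_trans; [apply Rabs_triang|]. lra.
Qed.

Lemma Ck_comp n U m V k h (g : nat -> vec -> R) :
  open_n n U -> open_n m V -> Ck m k V h -> (forall i, (i < m)%nat -> Ck n k U (g i)) ->
  (forall x, U x -> V (fun i => g i x)) -> Ck n k U (fun x => h (fun i => g i x)).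
Proof.
  intros HU HV. revert h. induction k as [|k IH]; intros h Hh Hg HUV.
  - now apply cont_on_comp with (V := V) (m := m).
  - apply Ck_succ with (fun j x =>
      sumn m (fun i => partial i h (fun i => g i x) * partial j (g i) x)).
    + apply cont_on_comp with (V := V) (m := m); [now apply Ck_cont in Hh| |assumption].
      intros i Hi. now apply Ck_cont with (S k), Hg.
    + intros j x Hj Hx.
      pose proof (chain_rule m V h (fun i t => g i (upd x j t)) (fun i => partial j (g i) x)
        (x j)) as P.
      cbv beta in P. rewrite upd_id in P. apply P; auto.
      * clear - Hh. induction k as [|k IH]; [assumption|]. now apply IH, Ck_pred.
      * intros i Hi. apply Ck_is_derive with n k U; auto.
    + intros j Hj.
      apply (Ck_sumn n k U m (fun i x => partial i h (fun i => g i x) * partial j (g i) x)).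
      intros i Hi. apply Ck_mult; [|now apply Ck_partial; auto].
      apply IH; auto; [now apply Ck_partial|]. intros. now apply Ck_pred, Hg.
Qed.

(** * Smooth functions of one variable *)

Definition Ck1 (k : nat) (V : R -> Prop) (f : R -> R) : Prop :=
  Ck 1 k (fun x => V (x 0%nat)) (fun x => f (x 0%nat)).

Lemma open_line V : open V -> open_n 1 (fun x => V (x 0%nat)).
Proof.
  intros H x Hx. destruct (H _ Hx) as [d Hd]. exists d. split; [apply cond_pos|].
  intros y Hy. apply Hd, Hy. lia.
Qed.

Lemma Ck_comp1 n k U V f h :
  open_n n U -> open V -> Ck1 k V f -> Ck n k U h -> (forall x, U x -> V (h x)) ->
  Ck n k U (fun x => f (h x)).
Proof.
  intros HU HV Hf Hh HUV.
  apply (Ck_comp n U 1 (fun x => V (x 0%nat)) k (fun x => f (x 0%nat)) (fun _ => h)); auto.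
  now apply open_line.
Qed.

Lemma Ck1_cont V f f' : (forall a, V a -> is_derive f a (f' a)) -> Ck1 0 V f.
Proof.
  intros H. apply cont_on_filterlim. intros x Hx.
  apply filterlim_comp with (locally (x 0%nat)).
  - intros P [d HP]. exists d. split; [apply cond_pos|]. intros y Hy _. apply HP, Hy. lia.
  - apply (ex_derive_continuous f). eexists. now apply H.
Qed.

Lemma Ck1_succ k V f f' :
  (forall a, V a -> is_derive f a (f' a)) -> Ck1 k V f' -> Ck1 (S k) V f.
Proof.
  intros Hd Hk. apply (Ck_succ 1 k _ _ (fun _ x => f' (x 0%nat))); [|
    |intros j Hj; exact Hk].
  - now apply Ck1_cont with f'.
  - intros j x Hj Hx. replace j with 0%nat by lia. now apply Hd.
Qed.

Lemma Ck1_of_derivative V f f' :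
  (forall a, V a -> is_derive f a (f' a)) ->
  (forall k, Ck1 k V f -> Ck1 k V f') -> forall k, Ck1 k V f.
Proof.
  intros Hd Hs k. induction k as [|k IH]; [now apply Ck1_cont with f'|].
  apply Ck1_succ with f'; auto.
Qed.

Lemma Ck1_inv k : Ck1 k (fun t => t <> 0) Rinv.
Proof.
  apply Ck1_of_derivative with (fun a => -1 * (/ a * / a)).
  - intros a Ha. auto_derive; [assumption|field; assumption].
  - intros k' H. apply Ck_mult; [apply Ck_const|]. now apply Ck_mult.
Qed.

Lemma Ck_inv n k U h :
  open_n n U -> Ck n k U h -> (forall x, U x -> h x <> 0) -> Ck n k U (fun x => / h x).
Proof.
  intros HU Hh Hn. apply Ck_comp1 with (fun t => t <> 0); auto using Ck1_inv.
  apply open_neq.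
Qed.

Lemma Ck_div n k U f h :
  open_n n U -> Ck n k U f -> Ck n k U h -> (forall x, U x -> h x <> 0) ->
  Ck n k U (fun x => f x / h x).
Proof. intros HU Hf Hh Hn. apply Ck_mult; [assumption|]. now apply Ck_inv. Qed.

Lemma Ck1_sqrt k : Ck1 k (fun t => 0 < t) sqrt.
Proof.
  apply Ck1_of_derivative with (fun a => / (2 * sqrt a)).
  - intros a Ha. apply is_derive_Reals. now apply derivable_pt_lim_sqrt.
  - intros k' H. apply (Ck_inv 1 k' _ (fun x => 2 * sqrt (x 0%nat))).
    + apply open_line, open_gt.
    + apply Ck_mult; [apply Ck_const|exact H].
    + intros x Hx. pose proof (sqrt_lt_R0 _ Hx). lra.
Qed.

Lemma Ck_sqrt n k U h :
  open_n n U -> Ck n k U h -> (forall x, U x -> 0 < h x) -> Ck n k U (fun x => sqrt (h x)).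
Proof.
  intros HU Hh Hp. apply Ck_comp1 with (fun t => 0 < t); auto using Ck1_sqrt. apply open_gt.
Qed.

Lemma Ck1_ln k : Ck1 k (fun t => 0 < t) ln.
Proof.
  apply Ck1_of_derivative with Rinv.
  - exact is_derive_ln.
  - intros k' _. apply Ck_sub with (fun x => x 0%nat <> 0); [intros; lra|apply Ck1_inv].
Qed.

Lemma Ck_ln n k U h :
  open_n n U -> Ck n k U h -> (forall x, U x -> 0 < h x) -> Ck n k U (fun x => ln (h x)).
Proof.
  intros HU Hh Hp. apply Ck_comp1 with (fun t => 0 < t); auto using Ck1_ln. apply open_gt.
Qed.

Lemma Ck1_exp k : Ck1 k (fun _ => True) exp.
Proof.
  apply Ck1_of_derivative with exp; [|auto]. intros a _. apply is_derive_exp.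
Qed.

Lemma open_unit_interval : open (fun t => -1 < t < 1).
Proof. apply open_and; [apply open_gt|apply open_lt]. Qed.

Lemma is_derive_acos a : -1 < a < 1 -> is_derive acos a (- / sqrt (1 - a ^ 2)).
Proof.
  intros Ha. apply is_derive_Reals.
  pose proof (derive_pt_acos a Ha) as E. destruct (derivable_pt_acos a Ha) as [l Hl].
  simpl in E. replace (- / sqrt (1 - a ^ 2)) with l; [exact Hl|].
  rewrite E. replace (1 - a ^ 2) with (1 - a²) by (unfold Rsqr; ring). unfold Rdiv. ring.
Qed.

Lemma Ck1_acos k : Ck1 k (fun t => -1 < t < 1) acos.
Proof.
  apply Ck1_of_derivative with (fun a => - / sqrt (1 - a ^ 2)); [exact is_derive_acos|].
  intros k' _. assert (HO := open_line _ open_unit_interval).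
  apply Ck_ext with (fun x => -1 * / sqrt (1 - x 0%nat * x 0%nat)); [exact HO| |].
  { intros x _. replace (x 0%nat ^ 2) with (x 0%nat * x 0%nat) by ring. ring. }
  assert (Hpos : forall x : vec, -1 < x 0%nat < 1 -> 0 < 1 - x 0%nat * x 0%nat) by (intros; nra).
  apply Ck_mult; [apply Ck_const|]. apply Ck_inv; [exact HO| |].
  - apply Ck_sqrt; auto. apply Ck_minus; [apply Ck_const|]. apply Ck_mult; apply Ck_proj; lia.
  - intros x Hx. apply Rgt_not_eq, sqrt_lt_R0. auto.
Qed.

Lemma Ck_acos n k U h :
  open_n n U -> Ck n k U h -> (forall x, U x -> -1 < h x < 1) -> Ck n k U (fun x => acos (h x)).
Proof.
  intros HU Hh Hp. apply Ck_comp1 with (fun t => -1 < t < 1); auto using Ck1_acos.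
  apply open_unit_interval.
Qed.

Lemma sqr_lt_ratio_lt_1 N d : 0 < d -> N * N < d * d -> -1 < N / d < 1.
Proof.
  intros Hd HN. assert (- d < N < d) by nra.
  split; apply Rmult_lt_reg_r with d; auto; unfold Rdiv; rewrite Rmult_assoc, Rinv_l; lra.
Qed.

Lemma is_derive_acos_div (N d : R -> R) (t N' d' : R) :
  is_derive N t N' -> is_derive d t d' -> 0 < d t -> N t * N t < d t * d t ->
  is_derive (fun s => acos (N s / d s)) t
    (- (N' - N t * d' / d t) / sqrt (d t * d t - N t * N t)).
Proof.
  intros HN Hd Pd Hlt. pose proof (sqr_lt_ratio_lt_1 _ _ Pd Hlt) as Hk.
  assert (Pg : 0 < d t * d t - N t * N t) by lra. pose proof (sqrt_lt_R0 _ Pg) as Rg.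
  assert (Es : sqrt (1 - (N t / d t) ^ 2) = sqrt (d t * d t - N t * N t) / d t).
  { replace (1 - (N t / d t) ^ 2) with ((d t * d t - N t * N t) / (d t * d t)) by (field; lra).
    rewrite sqrt_div by nra. now rewrite sqrt_square by lra. }
  eapply is_derive_eq.
  - apply (is_derive_Rcomp acos); [now apply is_derive_acos|].
    exact (is_derive_div N d t N' d' HN Hd (Rgt_not_eq _ _ Pd)).
  - rewrite Es. field. lra.
Qed.

(** * The contraction principle *)

Lemma le_geometric_nonpos a K q : 0 <= q < 1 -> (forall m, a <= K * q ^ m) -> a <= 0.
Proof.
  intros Hq H.
  apply (is_lim_seq_le (fun _ => a) (fun m => K * q ^ m) a 0 H); [apply is_lim_seq_const|].
  replace (Finite 0) with (Rbar_mult K 0) by (simpl; f_equal; ring).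
  apply is_lim_seq_scal_l, is_lim_seq_geom. rewrite Rabs_right; lra.
Qed.

Lemma geometric_increments (u : nat -> R) C q :
  0 <= q < 1 -> (forall m, Rabs (u (S m) - u m) <= C * q ^ m) ->
  forall m k, Rabs (u (m + k)%nat - u m) <= C / (1 - q) * q ^ m * (1 - q ^ k).
Proof.
  intros Hq H m k. induction k as [|k IH].
  - rewrite Nat.add_0_r, Rminus_diag, Rabs_R0. simpl. lra.
  - rewrite Nat.add_succ_r.
    replace (u (S (m + k)) - u m) with ((u (S (m + k)) - u (m + k)%nat) + (u (m + k)%nat - u m))
      by ring.
    eapply Rle_trans; [apply Rabs_triang|].
    eapply Rle_trans; [apply (Rplus_le_compat _ _ _ _ (H (m + k)%nat) IH)|].
    right. rewrite pow_add. simpl. field. lra.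
Qed.

Lemma geometric_limit (u : nat -> R) C q :
  0 <= q < 1 -> (forall m, Rabs (u (S m) - u m) <= C * q ^ m) ->
  forall m, Rabs (real (Lim_seq u) - u m) <= C / (1 - q) * q ^ m.
Proof.
  intros Hq H.
  assert (HC : 0 <= C)
    by (specialize (H O); simpl in H; pose proof (Rabs_pos (u 1%nat - u O)); lra).
  assert (HK : 0 <= C / (1 - q)) by (apply Rdiv_le_0_compat; lra).
  assert (Htail : forall m k, (m <= k)%nat -> Rabs (u k - u m) <= C / (1 - q) * q ^ m).
  { intros m k Hk. replace k with (m + (k - m))%nat by lia.
    eapply Rle_trans; [now apply geometric_increments|].
    rewrite <- (Rmult_1_r (C / (1 - q) * q ^ m)) at 2.
    pose proof (pow_le q m (proj1 Hq)). pose proof (pow_le q (k - m) (proj1 Hq)).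
    apply Rmult_le_compat_l; [now apply Rmult_le_pos|lra]. }
  assert (Hlim : ex_finite_lim_seq u).
  { apply ex_lim_seq_cauchy_corr. intros e.
    assert (Hq0 : is_lim_seq (fun m => C / (1 - q) * q ^ m) (C / (1 - q) * 0))
      by (apply is_lim_seq_mult'; [apply is_lim_seq_const|];
          apply is_lim_seq_geom; rewrite Rabs_right; lra).
    rewrite Rmult_0_r in Hq0.
    destruct (proj2 (is_lim_seq_spec _ _) Hq0 (pos_div_2 e)) as [N HN]. exists N.
    specialize (HN N (le_n N)). apply Rabs_def2 in HN. simpl in HN.
    intros a b Ha Hb.
    replace (u a - u b) with ((u a - u N) - (u b - u N)) by ring.
    eapply Rle_lt_trans; [apply Rabs_triang|]. rewrite Rabs_Ropp.
    pose proof (Htail N a Ha). pose proof (Htail N b Hb). lra. }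
  apply Lim_seq_correct' in Hlim. intros m.
  apply (is_lim_seq_le_loc (fun k => Rabs (u k - u m)) (fun _ => C / (1 - q) * q ^ m)
    (Rabs (real (Lim_seq u) - u m)) (C / (1 - q) * q ^ m)).
  - exists m. intros k Hk. now apply Htail.
  - apply (is_lim_seq_abs _ (Finite (real (Lim_seq u) - u m))), is_lim_seq_minus';
      [exact Hlim|apply is_lim_seq_const].
  - apply is_lim_seq_const.
Qed.

Lemma contraction_iterates n (T : vec -> vec) x0 r q :
  let C := supdist n x0 (T x0) in
  let u := fun m => Nat.iter m T x0 in
  0 <= q < 1 ->
  (forall x y, ball n x0 r x -> ball n x0 r y -> supdist n (T x) (T y) <= q * supdist n x y) ->
  C / (1 - q) < r ->
  forall m, supdist n x0 (u m) <= C / (1 - q) * (1 - q ^ m) /\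
            ball n x0 r (u m) /\ supdist n (u m) (u (S m)) <= C * q ^ m.
Proof.
  intros C u Hq HT HCr.
  assert (HCq : 0 <= C / (1 - q)) by (apply Rdiv_le_0_compat; [apply supnorm_nonneg|lra]).
  induction m as [|m (IHdist & IHball & IHstep)].
  - change (u 0%nat) with x0. change (u 1%nat) with (T x0). fold C. rewrite supdist_refl, pow_O.
    split; [lra|]. split; [apply ball_refl|]; lra.
  - assert (Hdist : supdist n x0 (u (S m)) <= C / (1 - q) * (1 - q ^ S m)).
    { eapply Rle_trans; [apply (supdist_triangle n x0 (u m))|].
      eapply Rle_trans; [apply (Rplus_le_compat _ _ _ _ IHdist IHstep)|].
      right. simpl. field. lra. }
    assert (Hball : ball n x0 r (u (S m))).
    { apply ball_of_supdist. pose proof (Rmult_le_pos _ _ HCq (pow_le q (S m) (proj1 Hq))). lra. }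
    split; [assumption|]. split; [assumption|].
    eapply Rle_trans; [apply (HT _ _ IHball Hball)|].
    replace (C * q ^ S m) with (q * (C * q ^ m)) by (simpl; ring).
    apply Rmult_le_compat_l; [lra|exact IHstep].
Qed.

Lemma contraction_fixed_point n (T : vec -> vec) x0 r q :
  0 <= q < 1 ->
  (forall x y, ball n x0 r x -> ball n x0 r y -> supdist n (T x) (T y) <= q * supdist n x y) ->
  supdist n x0 (T x0) / (1 - q) < r ->
  exists x, ball n x0 r x /\ eqn n (T x) x.
Proof.
  intros Hq HT HCr. pose proof (contraction_iterates n T x0 r q Hq HT HCr) as Hu.
  set (C := supdist n x0 (T x0)) in *. set (u := fun m => Nat.iter m T x0) in *.
  assert (HCq : 0 <= C / (1 - q)) by (apply Rdiv_le_0_compat; [apply supnorm_nonneg|lra]).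
  set (x := fun i => real (Lim_seq (fun m => u m i))).
  assert (Hx : forall m, supdist n (u m) x <= C / (1 - q) * q ^ m).
  { intros m. apply supnorm_le; [apply Rmult_le_pos; [assumption|apply pow_le; lra]|]. intros i Hi.
    apply (geometric_limit (fun m => u m i)); [assumption|]. intros m'.
    apply Rle_trans with (2 := proj2 (proj2 (Hu m'))).
    now apply (supdist_ge n (u m') (u (S m'))). }
  assert (Hball : ball n x0 r x).
  { apply ball_of_supdist. specialize (Hx 0%nat). rewrite pow_O, Rmult_1_r in Hx.
    now apply Rle_lt_trans with (1 := Hx). }
  exists x. split; [assumption|]. apply eqn_of_supdist.
  apply (le_geometric_nonpos _ (2 * (C / (1 - q)) + C) q Hq).
  intros m. destruct (Hu m) as (_ & Hb & Hs). specialize (Hx m).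
  assert (Hc : supdist n (T (u m)) (T x) <= 1 * supdist n (u m) x).
  { eapply Rle_trans; [now apply HT|]. apply Rmult_le_compat_r; [apply supnorm_nonneg|lra]. }
  eapply Rle_trans; [apply (supdist_triangle n _ (u m))|].
  eapply Rle_trans; [apply Rplus_le_compat_l, (supdist_triangle n _ (T (u m)))|].
  change (u (S m)) with (T (u m)) in Hs.
  rewrite (supdist_sym n x). lra.
Qed.

(** * Positive definite matrices *)

Definition mulv (n : nat) (A : nat -> nat -> R) (v : vec) (i : nat) : R :=
  sumn n (fun j => A i j * v j).

Definition posdef (n : nat) (A : nat -> nat -> R) : Prop :=
  forall v, (exists i, (i < n)%nat /\ v i <> 0) -> 0 < sumn n (fun i => v i * mulv n A v i).

Definition inverse_mx (n : nat) (A B : nat -> nat -> R) : Prop :=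
  forall v i, (i < n)%nat -> mulv n A (mulv n B v) i = v i /\ mulv n B (mulv n A v) i = v i.

Lemma mulv_ext n A v w i : eqn n v w -> mulv n A v i = mulv n A w i.
Proof. intros E. apply sumn_ext. intros j Hj. now rewrite (E j Hj). Qed.

Lemma mulv_minus n A v w i : mulv n A (fun j => v j - w j) i = mulv n A v i - mulv n A w i.
Proof. unfold mulv. rewrite <- sumn_minus. apply sumn_ext. intros; ring. Qed.

Lemma mulv_kron n A j i : (j < n)%nat -> mulv n A (kron j) i = A i j.
Proof.
  intros Hj. unfold mulv. rewrite (sumn_ext n _ (fun l => kron j l * A i l)) by (intros; ring).
  now apply sumn_kron.
Qed.

Definition mxnorm (n : nat) (A : nat -> nat -> R) : R :=
  sumn n (fun i => sumn n (fun j => Rabs (A i j))).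

Lemma mxnorm_nonneg n A : 0 <= mxnorm n A.
Proof. apply sumn_nonneg; intros; apply sumn_nonneg; intros; apply Rabs_pos. Qed.

Lemma mulv_supnorm n A v : supnorm n (mulv n A v) <= mxnorm n A * supnorm n v.
Proof.
  apply supnorm_le; [apply Rmult_le_pos; [apply mxnorm_nonneg|apply supnorm_nonneg]|].
  intros i Hi. eapply Rle_trans; [apply sumn_abs|].
  apply Rle_trans with (sumn n (fun j => Rabs (A i j)) * supnorm n v).
  - rewrite Rmult_comm, <- sumn_scal. apply sumn_le. intros j Hj. rewrite Rabs_mult, Rmult_comm.
    apply Rmult_le_compat_r; [apply Rabs_pos|now apply supnorm_ge].
  - apply Rmult_le_compat_r; [apply supnorm_nonneg|].
    apply (sumn_term_le n (fun i => sumn n (fun j => Rabs (A i j)))); [|assumption].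
    intros; apply sumn_nonneg; intros; apply Rabs_pos.
Qed.

Lemma posdef_injective n A v :
  posdef n A -> (forall i, (i < n)%nat -> mulv n A v i = 0) -> forall i, (i < n)%nat -> v i = 0.
Proof.
  intros HA Hv i Hi. destruct (Req_dec (v i) 0) as [|Hn]; [assumption|].
  specialize (HA v (ex_intro _ i (conj Hi Hn))).
  rewrite sumn_zero in HA by (intros l Hl; rewrite Hv by assumption; ring). lra.
Qed.

Lemma posdef_diag n A k : posdef n A -> (k < n)%nat -> 0 < A k k.
Proof.
  intros H Hk. specialize (H (kron k)).
  rewrite sumn_kron, mulv_kron in H by assumption.
  apply H. exists k. rewrite kron_refl. split; [assumption|lra].
Qed.

Definition schur (n : nat) (A : nat -> nat -> R) (i j : nat) : R :=
  A i j - A i n * (A n j * / A n n).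

Lemma schur_mulv n A v i :
  mulv n (schur n A) v i = mulv n A v i - A i n * / A n n * mulv n A v n.
Proof.
  unfold mulv, schur. rewrite <- sumn_scal, <- sumn_minus. apply sumn_ext. intros. ring.
Qed.

Lemma mulv_succ_upd n A v t i : mulv (S n) A (upd v n t) i = mulv n A v i + A i n * t.
Proof.
  unfold mulv. simpl. rewrite upd_same. f_equal. apply sumn_ext. intros j Hj.
  now rewrite upd_other by lia.
Qed.

Lemma posdef_schur n A : posdef (S n) A -> posdef n (schur n A).
Proof.
  intros H v [k [Hk Hv]].
  assert (Ha : 0 < A n n) by (apply (posdef_diag (S n)); auto).
  set (t := - (mulv n A v n / A n n)).
  specialize (H (upd v n t)). simpl in H. rewrite upd_same, mulv_succ_upd in H.
  replace (mulv n A v n + A n n * t) with 0 in H by (unfold t; field; lra).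
  rewrite (sumn_ext n _ (fun i => v i * mulv n (schur n A) v i)) in H.
  - rewrite Rmult_0_r, Rplus_0_r in H. apply H. exists k. split; [lia|].
    now rewrite upd_other by lia.
  - intros i Hi. rewrite upd_other, mulv_succ_upd, schur_mulv by lia. unfold t, Rdiv. ring.
Qed.

Lemma schur_back_substitution n A p q :
  A n n <> 0 ->
  (forall i, (i < n)%nat -> mulv n (schur n A) p i = q i - A i n * (q n * / A n n)) ->
  forall i, (i < S n)%nat ->
    mulv (S n) A (upd p n ((q n - mulv n A p n) * / A n n)) i = q i.
Proof.
  intros Ha H i Hi. rewrite mulv_succ_upd.
  destruct (Nat.eq_dec i n) as [->|Hn]; [field; assumption|].
  specialize (H i ltac:(lia)). rewrite schur_mulv in H.
  apply Rminus_diag_uniq. apply Rminus_diag_eq in H. rewrite <- H. ring.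
Qed.

Lemma posdef_solve d U n (A : nat -> nat -> vec -> R) (q : nat -> vec -> R) :
  open_n d U ->
  (forall i j, (i < n)%nat -> (j < n)%nat -> smooth_on d U (A i j)) ->
  (forall i, (i < n)%nat -> smooth_on d U (q i)) ->
  (forall x, U x -> posdef n (fun i j => A i j x)) ->
  exists p : nat -> vec -> R, (forall i, (i < n)%nat -> smooth_on d U (p i)) /\
    forall x i, U x -> (i < n)%nat ->
      mulv n (fun i j => A i j x) (fun j => p j x) i = q i x.
Proof.
  intros HU. revert A q. induction n as [|n IH]; intros A q HA Hq Hpos.
  - exists (fun _ _ => 0). split; intros; lia.
  - assert (Ha : forall x, U x -> 0 < A n n x)
      by (intros x Hx; apply (posdef_diag (S n) (fun i j => A i j x)); auto).
    assert (Hinv : smooth_on d U (fun x => / A n n x)).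
    { intros k. apply Ck_inv; [assumption|apply HA; lia|]. intros x Hx. apply Rgt_not_eq, Ha, Hx. }
    destruct (IH (fun i j x => schur n (fun i j => A i j x) i j)
                 (fun i x => q i x - A i n x * (q n x * / A n n x))) as [p [Hp Hs]].
    + intros i j Hi Hj k. unfold schur.
      apply Ck_minus; [|apply Ck_mult; [|apply Ck_mult]]; try apply HA; try apply Hinv; lia.
    + intros i Hi k.
      apply Ck_minus; [|apply Ck_mult; [|apply Ck_mult]];
        try apply HA; try apply Hinv; try apply Hq; lia.
    + intros x Hx. apply (posdef_schur n (fun i j => A i j x)). now apply Hpos.
    + set (last := fun x => (q n x - sumn n (fun j => A n j x * p j x)) * / A n n x).
      exists (fun i => if Nat.eqb i n then last else p i). split.
      * intros i Hi k. destruct (Nat.eqb_spec i n) as [->|Hn]; [|apply Hp; lia].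
        apply Ck_mult; [|apply Hinv]. apply Ck_minus; [apply Hq; lia|].
        apply (Ck_sumn d k U n (fun j x => A n j x * p j x)). intros j Hj.
        apply Ck_mult; [apply HA; lia|now apply Hp].
      * intros x i Hx Hi.
        replace (fun j => (if Nat.eqb j n then last else p j) x)
          with (upd (fun j => p j x) n (last x))
          by (extensionality j; unfold upd; now destruct (Nat.eqb j n)).
        apply (schur_back_substitution n (fun i j => A i j x) (fun j => p j x) (fun i => q i x)).
        -- now apply Rgt_not_eq, Ha.
        -- intros l Hl. now apply Hs.
        -- assumption.
Qed.

Lemma posdef_smooth_inverse d U n (A : nat -> nat -> vec -> R) :
  open_n d U ->
  (forall i j, (i < n)%nat -> (j < n)%nat -> smooth_on d U (A i j)) ->
  (forall x, U x -> posdef n (fun i j => A i j x)) ->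
  exists B : nat -> nat -> vec -> R,
    (forall i j, (i < n)%nat -> (j < n)%nat -> smooth_on d U (B i j)) /\
    forall x, U x -> inverse_mx n (fun i j => A i j x) (fun i j => B i j x).
Proof.
  intros HU HA Hpos.
  destruct (functional_choice (fun (k : nat) (p : nat -> vec -> R) =>
    (forall i, (i < n)%nat -> smooth_on d U (p i)) /\
    forall x i, U x -> (i < n)%nat ->
      mulv n (fun i j => A i j x) (fun j => p j x) i = kron i k)) as [C HC].
  { intros k. apply (posdef_solve d U n A (fun i _ => kron i k)); auto.
    intros i _ k'. apply Ck_const. }
  exists (fun i j => C j i). split; [intros i j Hi Hj; now apply HC|]. intros x Hx.
  assert (Hright : forall v i, (i < n)%nat ->
    mulv n (fun i j => A i j x) (mulv n (fun i j => C j i x) v) i = v i).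
  { intros v i Hi. unfold mulv at 1.
    rewrite (sumn_ext n _ (fun l => sumn n (fun j => v j * (A i l x * C j l x))))
      by (intros; unfold mulv; rewrite <- sumn_scal; apply sumn_ext; intros; ring).
    rewrite sumn_swap, (sumn_ext n _ (fun j => kron i j * v j)); [now apply sumn_kron|].
    intros j Hj. rewrite sumn_scal, <- (proj2 (HC j) x i Hx Hi). unfold mulv. ring. }
  intros v i Hi. split; [now apply Hright|]. apply Rminus_diag_uniq.
  apply (posdef_injective n (fun i j => A i j x)
    (fun i => mulv n (fun i j => C j i x) (mulv n (fun i j => A i j x) v) i - v i)); auto.
  intros l Hl. rewrite mulv_minus, (Hright (mulv n (fun i j => A i j x) v)) by assumption. ring.
Qed.

Definition det3 (m11 m12 m13 m22 m23 m33 : R) : R :=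
  m11 * (m22 * m33 - m23 * m23) - m12 * (m12 * m33 - m23 * m13) + m13 * (m12 * m23 - m22 * m13).

Definition form3 (m11 m12 m13 m22 m23 m33 v1 v2 v3 : R) : R :=
  v1 * (m11 * v1 + m12 * v2 + m13 * v3) + v2 * (m12 * v1 + m22 * v2 + m23 * v3)
  + v3 * (m13 * v1 + m23 * v2 + m33 * v3).

Lemma form3_semidefinite m11 m12 m13 m22 m23 m33 v1 v2 v3 :
  0 < m33 -> 0 < m11 * m33 - m13 * m13 -> 0 <= det3 m11 m12 m13 m22 m23 m33 ->
  0 <= form3 m11 m12 m13 m22 m23 m33 v1 v2 v3 /\
  (form3 m11 m12 m13 m22 m23 m33 v1 v2 v3 = 0 ->
   m11 * v1 + m12 * v2 + m13 * v3 = 0 /\ m12 * v1 + m22 * v2 + m23 * v3 = 0 /\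
   m13 * v1 + m23 * v2 + m33 * v3 = 0).
Proof.
  intros Hm33 Hminor Hdet. set (Q := form3 _ _ _ _ _ _ _ _ _). set (d := det3 _ _ _ _ _ _) in *.
  set (a := m11 * m33 - m13 * m13) in *. set (h := m33 * m12 - m13 * m23).
  assert (Hsquares : a * m33 * Q = a * (m13 * v1 + m23 * v2 + m33 * v3) ^ 2
      + (a * v1 + h * v2) ^ 2 + m33 * d * v2 ^ 2)
    by (unfold Q, a, d, h, form3, det3; ring).
  assert (Hterm3 : 0 <= a * (m13 * v1 + m23 * v2 + m33 * v3) ^ 2)
    by (apply Rmult_le_pos; [lra|apply pow2_ge_0]).
  pose proof (pow2_ge_0 (a * v1 + h * v2)) as Hterm1.
  assert (Hterm2 : 0 <= m33 * d * v2 ^ 2)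
    by (apply Rmult_le_pos; [apply Rmult_le_pos; lra|apply pow2_ge_0]).
  assert (Hlead : 0 < a * m33) by now apply Rmult_lt_0_compat.
  split; [apply Rmult_le_reg_l with (a * m33); lra|].
  intros HQ. rewrite HQ, Rmult_0_r in Hsquares.
  assert (Hrow3 : m13 * v1 + m23 * v2 + m33 * v3 = 0).
  { apply Rsqr_0_uniq. unfold Rsqr. apply Rmult_eq_reg_l with a; lra. }
  assert (Hcomb : a * v1 + h * v2 = 0) by (apply Rsqr_0_uniq; unfold Rsqr; lra).
  assert (Hdet_v2 : d * v2 = 0).
  { assert (Z : d * v2 ^ 2 = 0) by (apply Rmult_eq_reg_l with m33; lra).
    apply Rmult_integral in Z. destruct Z as [->|Z]; [ring|].
    rewrite (Rsqr_0_uniq v2); [ring|unfold Rsqr; lra]. }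
  assert (Hrow1 : m11 * v1 + m12 * v2 + m13 * v3 = 0).
  { apply Rmult_eq_reg_l with m33; [|lra].
    replace (m33 * (m11 * v1 + m12 * v2 + m13 * v3))
      with (a * v1 + h * v2 + m13 * (m13 * v1 + m23 * v2 + m33 * v3)) by (unfold a, h; ring).
    rewrite Hcomb, Hrow3. ring. }
  repeat split; [assumption| |assumption]. apply Rmult_eq_reg_l with (a * m33); [|lra].
  replace (a * m33 * (m12 * v1 + m22 * v2 + m23 * v3))
    with (h * (a * v1 + h * v2) + m33 * (d * v2) + a * m23 * (m13 * v1 + m23 * v2 + m33 * v3))
    by (unfold a, h, d, det3; ring).
  rewrite Hcomb, Hdet_v2, Hrow3. ring.
Qed.

Lemma det3_kernel m11 m12 m13 m22 m23 m33 v1 v2 v3 :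
  det3 m11 m12 m13 m22 m23 m33 <> 0 ->
  m11 * v1 + m12 * v2 + m13 * v3 = 0 -> m12 * v1 + m22 * v2 + m23 * v3 = 0 ->
  m13 * v1 + m23 * v2 + m33 * v3 = 0 -> v1 = 0 /\ v2 = 0 /\ v3 = 0.
Proof.
  intros Hd Hrow1 Hrow2 Hrow3.
  assert (Hcramer : forall x, det3 m11 m12 m13 m22 m23 m33 * x = 0 -> x = 0)
    by (intros x Hx; apply Rmult_integral in Hx; tauto).
  unfold det3 in Hcramer. repeat split; apply Hcramer; nsatz.
Qed.

(** * The inverse function theorem *)

Definition jacobian (f : vec -> vec) (x : vec) (i j : nat) : R := partial j (fun y => f y i) x.

Definition near_identity (n : nat) (x0 : vec) (r : R) (h : vec -> vec) : Prop :=
  forall x y i, ball n x0 r x -> ball n x0 r y -> (i < n)%nat ->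
    Rabs (h y i - h x i - (y i - x i)) <= / 2 * supdist n x y.

Lemma near_identity_expanding n x0 r h x y :
  near_identity n x0 r h -> ball n x0 r x -> ball n x0 r y ->
  supdist n x y <= 2 * supdist n (h x) (h y).
Proof.
  intros H Hx Hy.
  assert (K : supdist n x y <= / 2 * supdist n x y + supdist n (h x) (h y)); [|lra].
  apply supnorm_le.
  - pose proof (supnorm_nonneg n (fun i => y i - x i)).
    pose proof (supnorm_nonneg n (fun i => h y i - h x i)). unfold supdist. lra.
  - intros i Hi. specialize (H x y i Hx Hy Hi).
    replace (y i - x i) with ((h y i - h x i) - (h y i - h x i - (y i - x i))) by ring.
    eapply Rle_trans; [apply Rabs_triang|]. rewrite Rabs_Ropp.
    pose proof (supdist_ge n (h x) (h y) i Hi). lra.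
Qed.

Lemma near_identity_surjective n x0 r h w :
  near_identity n x0 r h -> 0 < r -> ball n (h x0) (r / 2) w ->
  exists x, ball n x0 r x /\ eqn n (h x) w.
Proof.
  intros H Hr Hw. set (T := fun x i => x i - h x i + w i).
  destruct (contraction_fixed_point n T x0 r (/ 2)) as [x [Hx E]].
  - lra.
  - intros x y Hx Hy. apply supnorm_le.
    + apply Rmult_le_pos; [lra|apply supnorm_nonneg].
    + intros i Hi. unfold T. specialize (H x y i Hx Hy Hi). rewrite <- Rabs_Ropp.
      replace (- _) with (h y i - h x i - (y i - x i)) by ring. exact H.
  - replace r with (r / 2 / (1 - / 2)) by field. apply Rmult_lt_compat_r; [lra|].
    apply supdist_lt_of_ball; [lra|].
    intros i Hi. unfold T. replace (_ - x0 i) with (w i - h x0 i) by ring. now apply Hw.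
  - exists x. split; [assumption|]. intros i Hi. specialize (E i Hi). unfold T in E. lra.
Qed.

Lemma strictly_differentiable_map n D f x0 :
  open_n n D -> (forall i, (i < n)%nat -> Ck n 1 D (fun x => f x i)) -> D x0 ->
  forall e, 0 < e -> exists d, 0 < d /\ (forall x, ball n x0 d x -> D x) /\
    forall x y, ball n x0 d x -> ball n x0 d y ->
      supnorm n (fun i => f y i - f x i - mulv n (jacobian f x0) (fun j => y j - x j) i)
        <= e * supdist n x y.
Proof.
  intros HD Hf Hx0 e He.
  assert (H : filter_prod (nbhds n x0) (nbhds n x0) (fun p => forall i, (i < n)%nat ->
    Rabs (f (snd p) i - f (fst p) i - mulv n (jacobian f x0) (fun j => snd p j - fst p j) i)
      <= e * supdist n (fst p) (snd p))).
  { apply (filter_forall_lt (filter_prod (nbhds n x0) (nbhds n x0))). intros i Hi.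
    destruct (strictly_differentiable n D (fun x => f x i) x0 HD (Hf i Hi) Hx0 e He)
      as [d [Hd [_ Hb]]].
    exists (ball n x0 d) (ball n x0 d); auto using nbhds_ball. }
  destruct H as [P Q HP HQ H].
  destruct (filter_and (F := nbhds n x0) _ _ (HD x0 Hx0) (filter_and (F := nbhds n x0) _ _ HP HQ))
    as [d [Hd Hb]].
  exists d. split; [assumption|]. split; [intros x Hx; now apply Hb|].
  intros x y Hx Hy. apply supnorm_le; [apply Rmult_le_pos; [lra|apply supnorm_nonneg]|].
  apply (H x y); [now apply (Hb x)|now apply (Hb y)].
Qed.

Lemma inverse_jacobian_near_identity n D f x0 B :
  open_n n D -> (forall i, (i < n)%nat -> Ck n 1 D (fun x => f x i)) -> D x0 ->
  inverse_mx n (jacobian f x0) B ->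
  exists r, 0 < r /\ (forall x, ball n x0 r x -> D x) /\
    near_identity n x0 r (fun x => mulv n B (f x)).
Proof.
  intros HD Hf Hx0 HB. pose proof (mxnorm_nonneg n B) as HnB.
  destruct (strictly_differentiable_map n D f x0 HD Hf Hx0 (/ (2 * (mxnorm n B + 1))))
    as [r [Hr [HrD H]]]; [apply Rinv_0_lt_compat; lra|].
  exists r. split; [assumption|]. split; [assumption|]. intros x y i Hx Hy Hi.
  specialize (H x y Hx Hy). set (err := fun i => _) in H.
  replace (_ - _ - (y i - x i)) with (mulv n B err i).
  - eapply Rle_trans; [now apply (supnorm_ge n (mulv n B err))|].
    eapply Rle_trans; [apply mulv_supnorm|].
    eapply Rle_trans; [apply (Rmult_le_compat_l _ _ _ HnB H)|].
    rewrite <- Rmult_assoc. apply Rmult_le_compat_r; [apply supnorm_nonneg|].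
    apply Rmult_le_reg_r with (2 * (mxnorm n B + 1)); [lra|].
    rewrite Rmult_assoc, Rinv_l by lra. lra.
  - unfold err. rewrite (mulv_minus n B (fun i => f y i - f x i)), mulv_minus.
    now rewrite (proj2 (HB _ i Hi)).
Qed.

Lemma mulv_upd_minus n B z j t i :
  (j < n)%nat -> mulv n B (fun l => upd z j t l - z l) i = B i j * (t - z j).
Proof.
  intros Hj. unfold mulv.
  rewrite (sumn_ext n _ (fun l => kron j l * (B i l * (t - z l)))); [now rewrite sumn_kron|].
  intros l _. destruct (Nat.eq_dec l j) as [->|Hn].
  - rewrite upd_same, kron_refl. ring.
  - rewrite upd_other, kron_neq by auto. ring.
Qed.

Lemma supdist_upd n z j t : supdist n z (upd z j t) <= Rabs (t - z j).
Proof.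
  apply supnorm_le; [apply Rabs_pos|]. intros l _.
  destruct (Nat.eq_dec l j) as [->|Hn]; [rewrite upd_same; lra|].
  rewrite upd_other, Rminus_diag, Rabs_R0 by assumption. apply Rabs_pos.
Qed.

Lemma lipschitz_inverse_is_derive n D f g z B K i j :
  open_n n D -> (forall i, (i < n)%nat -> Ck n 1 D (fun x => f x i)) -> D (g z) ->
  inverse_mx n (jacobian f (g z)) B -> 0 < K ->
  nbhds n z (fun w => eqn n (f (g w)) w /\ supdist n (g z) (g w) <= K * supdist n z w) ->
  (i < n)%nat -> (j < n)%nat -> is_derive (fun t => g (upd z j t) i) (z j) (B i j).
Proof.
  intros HD Hf Hz HB HK Hg Hi Hj. set (x := g z) in *. pose proof (mxnorm_nonneg n B) as HnB.
  apply is_derive_increment. intros e He.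
  set (e' := e / ((mxnorm n B + 1) * K)).
  assert (He' : 0 < e') by (apply Rdiv_lt_0_compat; [|apply Rmult_lt_0_compat]; lra).
  destruct (strictly_differentiable_map n D f x HD Hf Hz e' He') as [d [Hd [_ Hdiff]]].
  assert (Hd' : 0 < d / K) by now apply Rdiv_lt_0_compat.
  destruct (nbhds_point _ _ _ Hg) as [Ez _].
  generalize (nbhds_upd n z j _ (filter_and _ _ Hg (nbhds_ball n z _ Hd'))).
  apply filter_imp. intros t [[Ew Hlip] Hw]. rewrite upd_id. fold x in Hlip, Ez |- *.
  set (y := g (upd z j t)) in *.
  assert (Hy : ball n x d y).
  { apply ball_of_supdist. apply supdist_lt_of_ball in Hw; [|assumption].
    apply Rle_lt_trans with (1 := Hlip).
    apply (Rmult_lt_compat_l K) in Hw; [|assumption].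
    replace (K * (d / K)) with d in Hw by (field; lra). exact Hw. }
  specialize (Hdiff x y (ball_refl n x d Hd) Hy). set (err := fun i => _) in Hdiff.
  replace (y i - x i - B i j * (t - z j)) with (- mulv n B err i).
  - rewrite Rabs_Ropp. eapply Rle_trans; [now apply (supnorm_ge n (mulv n B err))|].
    eapply Rle_trans; [apply mulv_supnorm|].
    eapply Rle_trans; [apply (Rmult_le_compat_l _ _ _ HnB Hdiff)|].
    apply Rle_trans with (mxnorm n B * (e' * (K * Rabs (t - z j)))).
    + apply Rmult_le_compat_l; [assumption|]. apply Rmult_le_compat_l; [lra|].
      apply Rle_trans with (1 := Hlip). apply Rmult_le_compat_l; [lra|apply supdist_upd].
    + replace (mxnorm n B * (e' * (K * Rabs (t - z j))))
        with (mxnorm n B / (mxnorm n B + 1) * (e * Rabs (t - z j))) by (unfold e'; field; lra).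
      rewrite <- (Rmult_1_l (e * Rabs (t - z j))) at 2.
      apply Rmult_le_compat_r; [apply Rmult_le_pos; [lra|apply Rabs_pos]|].
      apply Rmult_le_reg_r with (mxnorm n B + 1); [lra|].
      unfold Rdiv. rewrite Rmult_assoc, Rinv_l; lra.
  - unfold err. rewrite (mulv_minus n B (fun i => f y i - f x i)), (proj2 (HB _ i Hi)).
    rewrite (mulv_ext n B (fun i => f y i - f x i) (fun l => upd z j t l - z l)).
    + rewrite mulv_upd_minus by assumption. ring.
    + intros l Hl. now rewrite (Ew l Hl), (Ez l Hl).
Qed.

Lemma near_identity_inverse n (f : vec -> vec) J B x0 r :
  inverse_mx n J B -> 0 < r -> near_identity n x0 r (fun x => mulv n B (f x)) ->
  let W := fun z => ball n (mulv n B (f x0)) (r / 2) (mulv n B z) in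
  exists (g : vec -> vec) (K : R), 0 < K /\
    (forall z, W z -> ball n x0 r (g z) /\ eqn n (f (g z)) z) /\
    (forall y, ball n x0 r y -> W (f y) -> eqn n (g (f y)) y) /\
    (forall z w, W z -> W w -> supdist n (g z) (g w) <= K * supdist n z w).
Proof.
  intros HJB Hr Hnear W.
  set (g := fun z => epsilon (inhabits x0) (fun x => ball n x0 r x /\ eqn n (f x) z)).
  assert (Hg : forall z, W z -> ball n x0 r (g z) /\ eqn n (f (g z)) z).
  { intros z Hz. apply epsilon_spec.
    destruct (near_identity_surjective n x0 r _ _ Hnear Hr Hz) as [x [Hx E]].
    exists x. split; [assumption|]. intros i Hi.
    rewrite <- (proj1 (HJB (f x) i Hi)), <- (proj1 (HJB z i Hi)). now apply mulv_ext. }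
  assert (Hexp : forall x y, ball n x0 r x -> ball n x0 r y ->
    supdist n x y <= 2 * (mxnorm n B + 1) * supdist n (f x) (f y)).
  { intros x y Hx Hy. pose proof (supnorm_nonneg n (fun i => f y i - f x i)) as Hpos.
    eapply Rle_trans; [apply (near_identity_expanding n x0 r _ x y Hnear Hx Hy)|].
    rewrite Rmult_assoc. apply Rmult_le_compat_l; [lra|].
    unfold supdist in *. rewrite (supnorm_ext n _ (mulv n B (fun i => f y i - f x i)))
      by (intros i Hi; now rewrite mulv_minus).
    eapply Rle_trans; [apply mulv_supnorm|]. apply Rmult_le_compat_r; [assumption|lra]. }
  exists g, (2 * (mxnorm n B + 1)). split; [pose proof (mxnorm_nonneg n B); lra|].
  split; [assumption|]. split.
  - intros y Hy Wy. destruct (Hg _ Wy) as [By Ey]. apply eqn_of_supdist.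
    eapply Rle_trans; [now apply Hexp|]. unfold supdist.
    apply Rle_trans with (2 * (mxnorm n B + 1) * 0); [|lra].
    apply Rmult_le_compat_l; [pose proof (mxnorm_nonneg n B); lra|].
    apply supnorm_le; [lra|]. intros k Hk. rewrite (Ey k Hk), Rminus_diag, Rabs_R0. lra.
  - intros z w Hz Hw. destruct (Hg z Hz) as [Bz Ez]. destruct (Hg w Hw) as [Bw Ew].
    eapply Rle_trans; [now apply Hexp|]. right. f_equal. unfold supdist.
    apply supnorm_ext. intros i Hi. now rewrite (Ez i Hi), (Ew i Hi).
Qed.

Lemma lipschitz_inverse_smooth n D W f g (B : nat -> nat -> vec -> R) K :
  open_n n D -> smooth_map_on n D f ->
  (forall i j, (i < n)%nat -> (j < n)%nat -> smooth_on n D (B i j)) ->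
  (forall x, D x -> inverse_mx n (jacobian f x) (fun i j => B i j x)) ->
  open_n n W -> (forall z, W z -> D (g z) /\ eqn n (f (g z)) z) -> 0 < K ->
  (forall z w, W z -> W w -> supdist n (g z) (g w) <= K * supdist n z w) ->
  smooth_map_on n W g.
Proof.
  intros HD Hf HB HJB HW Hg HK Hlip.
  assert (Hcont : forall i, (i < n)%nat -> cont_on n W (fun z => g z i)).
  { intros i Hi z Hz e He. assert (He' : 0 < e / K) by now apply Rdiv_lt_0_compat.
    exists (e / K). split; [assumption|].
    intros w Hw Hzw. apply supdist_lt_of_ball in Hzw; [|assumption].
    eapply Rle_lt_trans; [now apply (supdist_ge n (g z) (g w))|].
    eapply Rle_lt_trans; [now apply Hlip|].
    apply (Rmult_lt_compat_l K) in Hzw; [|assumption].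
    replace (K * (e / K)) with e in Hzw by (field; lra). exact Hzw. }
  intros i Hi k. revert i Hi. induction k as [|k IH]; intros i Hi; [now apply Hcont|].
  apply Ck_succ with (fun j z => B i j (g z)).
  - now apply Hcont.
  - intros j z Hj Hz. destruct (Hg z Hz) as [Dz _].
    apply (lipschitz_inverse_is_derive n D f g z (fun i j => B i j (g z)) K i j); auto.
    + intros l Hl. now apply Hf.
    + generalize (HW z Hz). apply (filter_imp (F := nbhds n z)).
      intros w Hw. split; [now apply Hg|now apply Hlip].
  - intros j Hj. apply (Ck_comp n W n D k (B i j) (fun l z => g z l)); auto.
    + now apply HB.
    + intros z Hz. now apply Hg.
Qed.

Theorem inverse_function n D f (B : nat -> nat -> vec -> R) :
  open_n n D -> smooth_map_on n D f ->
  (forall i j, (i < n)%nat -> (j < n)%nat -> smooth_on n D (B i j)) ->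
  (forall x, D x -> inverse_mx n (jacobian f x) (fun i j => B i j x)) ->
  local_diffeo_between n D D (fun _ => True) f.
Proof.
  intros HD Hf HB HJB x0 Hx0. set (b := fun i j => B i j x0).
  destruct (inverse_jacobian_near_identity n D f x0 b HD (fun i Hi => Hf i Hi 1%nat) Hx0
    (HJB x0 Hx0)) as [r [Hr [HrD Hnear]]].
  destruct (near_identity_inverse n f _ b x0 r (HJB x0 Hx0) Hr Hnear)
    as [g [K [HK [Hfg [Hgf Hlip]]]]].
  set (W := fun z => ball n (mulv n b (f x0)) (r / 2) (mulv n b z)) in *.
  assert (HW : open_n n W).
  { apply (open_n_ext n (fun z => True /\ W z)); [tauto|].
    apply (open_n_preimage n (fun _ => True) n (ball n (mulv n b (f x0)) (r / 2))
      (fun i z => mulv n b z i)); [intros x _; exists 1; split; [lra|auto]|apply open_n_ball|].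
    intros i Hi. apply (Ck_cont n 0), (Ck_sumn n 0 _ n (fun j z => b i j * z j)).
    intros j Hj. apply Ck_mult; [apply Ck_const|now apply Ck_proj]. }
  exists (fun x => ball n x0 r x /\ W (f x)), W, g.
  split; [|split; [|split; [|split; [|split; [|split; [|split; [|split]]]]]]].
  - apply (open_n_preimage n (ball n x0 r) n W (fun i x => f x i)); auto using open_n_ball.
    intros i Hi. apply cont_on_sub with D; [assumption|]. now apply (Ck_cont n 0), Hf.
  - split; [now apply ball_refl|]. apply ball_refl. lra.
  - intros y [Hy _]. now apply HrD.
  - assumption.
  - apply ball_refl. lra.
  - intros i Hi k. apply Ck_sub with D; [now intros y [Hy _]; apply HrD|now apply Hf].
  - apply (lipschitz_inverse_smooth n D W f g B K); auto.
    intros z Hz. split; [apply HrD|]; now apply Hfg.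
  - intros y [Hy Wy] _. auto.
  - intros z Wz _. destruct (Hfg z Wz) as [Bz E]. repeat split; auto.
    intros i Hi. rewrite (mulv_ext n b (f (g z)) z i E). now apply Wz.
Qed.

Lemma inverse_mx_scale_columns n A B (c : vec) :
  (forall j, (j < n)%nat -> c j <> 0) -> inverse_mx n (fun i j => A i j * c j) B ->
  inverse_mx n A (fun i j => c i * B i j).
Proof.
  intros Hc H v i Hi.
  assert (HA : forall w l, mulv n A (fun j => c j * w j) l = mulv n (fun i j => A i j * c j) w l)
    by (intros; apply sumn_ext; intros; ring).
  assert (HB : forall w l, mulv n (fun i j => c i * B i j) w l = c l * mulv n B w l)
    by (intros; unfold mulv; rewrite <- sumn_scal; apply sumn_ext; intros; ring).
  split.
  - rewrite (mulv_ext n A _ (fun j => c j * mulv n B v j)) by (intros j _; apply HB).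
    rewrite HA. now apply H.
  - rewrite HB. pose proof (Hc i Hi).
    transitivity (c i * (v i / c i)); [|field; assumption].
    rewrite <- (proj2 (H (fun j => v j / c j) i Hi)). f_equal. apply mulv_ext.
    intros l _. rewrite <- HA. apply mulv_ext. intros j Hj. field. now apply Hc.
Qed.

(* The factors [c] allow for a change of parameters [d x_j = c_j d u_j]. *)
Lemma inverse_function_scaled_posdef n D f (c : nat -> vec -> R) :
  open_n n D -> smooth_map_on n D f ->
  (forall j, (j < n)%nat -> smooth_on n D (c j)) ->
  (forall j x, (j < n)%nat -> D x -> c j x <> 0) ->
  (forall x, D x -> posdef n (fun i j => jacobian f x i j * c j x)) ->
  local_diffeo_between n D D (fun _ => True) f.
Proof.
  intros HD Hf Hc Hc0 HJ.
  destruct (posdef_smooth_inverse n D n (fun i j x => jacobian f x i j * c j x) HD)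
    as [C [HC HJC]]; [|exact HJ|].
  - intros i j Hi Hj k. apply Ck_mult; [|now apply Hc].
    now apply Ck_partial; [| apply Hf|].
  - apply (inverse_function n D f (fun i j x => c i x * C i j x)); auto.
    + intros i j Hi Hj k. now apply Ck_mult; [apply Hc|apply HC].
    + intros x Hx. apply (inverse_mx_scale_columns n _ (fun i j => C i j x) (fun j => c j x)); auto.
Qed.

Lemma local_diffeo_locally_injective n D M N f x :
  local_diffeo_between n D M N f -> M x ->
  exists U, open_n n U /\ U x /\
    forall y z, U y -> U z -> M y -> M z -> eqn n (f y) (f z) -> eqn n y z.
Proof.
  intros H Hx. destruct (H x Hx) as (U & W & g & HU & Ux & _ & _ & _ & _ & Hg & Hgf & _).
  exists U. split; [assumption|]. split; [assumption|]. intros y z Uy Uz My Mz E i Hi.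
  destruct (Hgf y Uy My) as (Wy & _ & Ey). destruct (Hgf z Uz Mz) as (Wz & _ & Ez).
  rewrite <- (Ey i Hi), <- (Ez i Hi).
  symmetry. apply (cont_on_eqn n W (fun w => g w i)); auto. now apply (Ck_cont n 0), Hg.
Qed.

Lemma local_diffeo_restrict n D M N f f' :
  local_diffeo_between n D D (fun _ => True) f -> smooth_map_on n D f' ->
  (forall x y, eqn n x y -> N x -> N y) ->
  (forall x, M x <-> D x /\ N (f x)) -> (forall x, M x -> f x = f' x) ->
  local_diffeo_between n D M N f'.
Proof.
  intros Hf Hf' HN HM E x Mx. destruct (proj1 (HM x) Mx) as [Dx _].
  destruct (Hf x Dx) as (U & W & g & HU & Ux & HUD & HW & Wx & _ & Hg & Hgf & Hfg).
  exists U, W, g. rewrite <- (E x Mx).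
  split; [|split; [|split; [|split; [|split; [|split; [|split; [|split]]]]]]]; auto.
  - intros i Hi k. apply Ck_sub with D; [assumption|now apply Hf'].
  - intros y Uy My. rewrite <- (E y My). destruct (proj1 (HM y) My) as [Dy Ny].
    destruct (Hgf y Uy Dy) as (Wy & _ & Ey). auto.
  - intros z Wz Nz. destruct (Hfg z Wz Logic.I) as (Ug & Dg & Ez).
    assert (Mg : M (g z)).
    { apply HM. split; [assumption|]. apply (HN z); [|assumption].
      intros i Hi. symmetry. auto. }
    rewrite <- (E _ Mg). auto.
Qed.

(** * Sums over lists and corners of triangles *)

Definition lsum {A : Type} (F : list A) (g : A -> R) : R := fold_right (fun t s => g t + s) 0 F.

Lemma lsum_ext {A : Type} (F : list A) g h :
  (forall t, In t F -> g t = h t) -> lsum F g = lsum F h.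
Proof.
  induction F as [|t F IH]; intros H; simpl; [reflexivity|].
  rewrite H by now left. f_equal. apply IH. intros. apply H. now right.
Qed.

Lemma lsum_scal {A : Type} (F : list A) c g : lsum F (fun t => c * g t) = c * lsum F g.
Proof. induction F as [|t F IH]; simpl; [ring|]. rewrite IH. ring. Qed.

Lemma lsum_const {A : Type} (F : list A) c : lsum F (fun _ => c) = c * INR (length F).
Proof.
  induction F as [|t F IH]; [simpl; ring|]. cbn [length]. rewrite S_INR. simpl. rewrite IH. ring.
Qed.

Lemma sumn_lsum {A : Type} n (F : list A) g :
  sumn n (fun i => lsum F (g i)) = lsum F (fun t => sumn n (fun i => g i t)).
Proof.
  induction F as [|t F IH]; simpl; [now apply sumn_zero|]. now rewrite sumn_plus, IH.
Qed.

Lemma lsum_nonneg {A : Type} (F : list A) g : (forall t, In t F -> 0 <= g t) -> 0 <= lsum F g.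
Proof.
  induction F as [|t F IH]; intros H; simpl; [lra|].
  apply Rplus_le_le_0_compat; [apply H; now left|]. apply IH. intros. apply H. now right.
Qed.

Lemma lsum_nonneg_eq_0 {A : Type} (F : list A) g :
  (forall t, In t F -> 0 <= g t) -> lsum F g = 0 -> forall t, In t F -> g t = 0.
Proof.
  induction F as [|u F IH]; intros H E t Ht; [destruct Ht|]. simpl in E.
  assert (Hu : 0 <= g u) by (apply H; now left).
  assert (HF : forall t, In t F -> 0 <= g t) by (intros; apply H; now right).
  pose proof (lsum_nonneg F g HF) as Hsum.
  destruct Ht as [->|Ht]; [lra|]. apply IH; [assumption|lra|assumption].
Qed.

Lemma Ck_lsum {A : Type} n k U (F : list A) (g : A -> vec -> R) :
  (forall t, In t F -> Ck n k U (g t)) -> Ck n k U (fun r => lsum F (fun t => g t r)).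
Proof.
  induction F as [|t F IH]; intros H; simpl; [apply Ck_const|].
  apply Ck_plus; [apply H; now left|]. apply IH. intros. apply H. now right.
Qed.

Lemma is_derive_lsum {A : Type} (F : list A) (g : A -> R -> R) (g' : A -> R) x :
  (forall t, In t F -> is_derive (g t) x (g' t)) ->
  is_derive (fun s => lsum F (fun t => g t s)) x (lsum F g').
Proof.
  induction F as [|t F IH]; intros H; simpl; [apply is_derive_Rconst|].
  apply (is_derive_Rplus (g t) (fun s => lsum F (fun t => g t s))); [apply H; now left|].
  apply IH. intros. apply H. now right.
Qed.

Lemma open_n_forall_in {A : Type} n U (F : list A) (P : A -> vec -> Prop) :
  open_n n U -> (forall t, In t F -> open_n n (fun r => U r /\ P t r)) ->
  open_n n (fun r => U r /\ forall t, In t F -> P t r).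
Proof.
  intros HU. induction F as [|t F IH]; intros H.
  - apply (open_n_ext n U); [|assumption]. intros r. split; [|tauto].
    intros Ur. split; [assumption|intros ? []].
  - apply (open_n_ext n (fun r => (U r /\ P t r) /\ U r /\ forall t, In t F -> P t r)).
    + intros r. split.
      * intros ((Ur & Pt) & _ & PF). split; [assumption|]. intros u [<-|Hu]; auto.
      * intros (Ur & PF). repeat split; auto with datatypes.
    + apply open_n_and; [apply H; now left|]. apply IH. intros u Hu. apply H. now right.
Qed.

Definition at_vertex {A : Type} (t : tri) (i : nat) (f : nat -> nat -> nat -> A) (d : A) : A :=
  let '(a, b, c) := t in
  if Nat.eqb i a then f a b c else if Nat.eqb i b then f b a c
  else if Nat.eqb i c then f c a b else d.

Definition corner (t : tri) (i j k : nat) : Prop :=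
  let '(a, b, c) := t in
  (i, j, k) = (a, b, c) \/ (i, j, k) = (b, a, c) \/ (i, j, k) = (c, a, b).

Lemma at_vertex_spec t i :
  (exists j k, corner t i j k /\ forall (A : Type) f (d : A), at_vertex t i f d = f i j k) \/
  (forall (A : Type) f (d : A), at_vertex t i f d = d).
Proof.
  destruct t as [[a b] c]. unfold at_vertex, corner.
  destruct (Nat.eqb_spec i a) as [->|]; [left; exists b, c; auto|].
  destruct (Nat.eqb_spec i b) as [->|]; [left; exists a, c; auto|].
  destruct (Nat.eqb_spec i c) as [->|]; [left; exists a, b; auto|now right].
Qed.

Lemma sumn_at_vertex n a b c f :
  (a < n)%nat -> (b < n)%nat -> (c < n)%nat -> a <> b -> b <> c -> a <> c ->
  sumn n (fun i => at_vertex (a, b, c) i f 0) = f a b c + f b a c + f c a b.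
Proof.
  intros Ha Hb Hc Hab Hbc Hac.
  rewrite (sumn_ext n _ (fun i => kron a i * f a b c + kron b i * f b a c + kron c i * f c a b)).
  - rewrite !sumn_plus, (sumn_kron n a (fun _ => f a b c)), (sumn_kron n b (fun _ => f b a c)),
      (sumn_kron n c (fun _ => f c a b)) by assumption. reflexivity.
  - intros i _. unfold at_vertex, kron. rewrite !(Nat.eqb_sym i).
    destruct (Nat.eqb_spec a i), (Nat.eqb_spec b i), (Nat.eqb_spec c i); subst;
      try congruence; ring.
Qed.

(** * Triangles in a plane of constant nonpositive curvature *)

(* The functions [sn] and [cs] are [id] and [1] in the Euclidean plane, [sinh] and [cosh] in the
   hyperbolic plane; the Gaussian curvature is [- curv]. *)
Record trigonometry := Trigonometry {
  curv : R;
  sn : R -> R;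
  cs : R -> R;
  curv_nonneg : 0 <= curv;
  sn_pos : forall x, 0 < x -> 0 < sn x;
  cs_pos : forall x, 0 < cs x;
  cs_sqr : forall x, cs x * cs x = 1 + curv * (sn x * sn x);
  is_derive_sn : forall x, is_derive sn x (cs x);
  is_derive_cs : forall x, is_derive cs x (curv * sn x)
}.

Lemma Ck1_sn_cs T k : Ck1 k (fun _ => True) (sn T) /\ Ck1 k (fun _ => True) (cs T).
Proof.
  induction k as [|k [IHs IHc]]; split.
  - apply Ck1_cont with (cs T). intros; apply is_derive_sn.
  - apply Ck1_cont with (fun x => curv T * sn T x). intros; apply is_derive_cs.
  - apply Ck1_succ with (cs T); [intros; apply is_derive_sn|assumption].
  - apply Ck1_succ with (fun x => curv T * sn T x); [intros; apply is_derive_cs|].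
    apply Ck_mult; [apply Ck_const|exact IHs].
Qed.

Lemma Ck_sn T n k U i : open_n n U -> (i < n)%nat -> Ck n k U (fun r => sn T (r i)).
Proof.
  intros HU Hi. apply (Ck_comp1 n k U (fun _ => True)); auto using Ck_proj, open_true.
  apply Ck1_sn_cs.
Qed.

Lemma Ck_cs T n k U i : open_n n U -> (i < n)%nat -> Ck n k U (fun r => cs T (r i)).
Proof.
  intros HU Hi. apply (Ck_comp1 n k U (fun _ => True)); auto using Ck_proj, open_true.
  apply Ck1_sn_cs.
Qed.

Section Circle_packing.

Variables (T : trigonometry) (I : nat -> nat -> R).
Hypothesis I_sym : forall i j, I i j = I j i.

(* [cs] and the square of [sn] of the distance of the centres of the circles [i] and [j]. *)
Definition cs_side (r : vec) (i j : nat) : R :=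
  cs T (r i) * cs T (r j) + curv T * I i j * sn T (r i) * sn T (r j).

Definition sn2_side (r : vec) (i j : nat) : R :=
  sn T (r i) * sn T (r i) + sn T (r j) * sn T (r j)
  + 2 * I i j * sn T (r i) * sn T (r j) * cs T (r i) * cs T (r j)
  + curv T * (1 + I i j * I i j) * sn T (r i) * sn T (r i) * sn T (r j) * sn T (r j).

(* The numerator of the law of cosines for the angle at [i]: [cs cs - cs = curv * cos_num]
   for the three sides; the factor [curv] is divided out so that the Euclidean case is included. *)
Definition cos_num (r : vec) (i j k : nat) : R :=
  sn T (r i) * sn T (r i) * cs T (r j) * cs T (r k)
  + I i j * sn T (r i) * sn T (r j) * cs T (r i) * cs T (r k)
  + I i k * sn T (r i) * sn T (r k) * cs T (r i) * cs T (r j)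
  + (curv T * I i j * I i k * sn T (r i) * sn T (r i) - I j k) * sn T (r j) * sn T (r k).

Definition gram (r : vec) (i j k : nat) : R :=
  sn2_side r i j * sn2_side r i k - cos_num r i j k * cos_num r i j k.

Definition angle (r : vec) (i j k : nat) : R :=
  acos (cos_num r i j k / (sqrt (sn2_side r i j) * sqrt (sn2_side r i k))).

Lemma sn2_side_sym r i j : sn2_side r i j = sn2_side r j i.
Proof. unfold sn2_side. rewrite (I_sym j i). ring. Qed.

Lemma cs_side_sym r i j : cs_side r i j = cs_side r j i.
Proof. unfold cs_side. rewrite (I_sym j i). ring. Qed.

Lemma cos_num_swap r i j k : cos_num r i j k = cos_num r i k j.
Proof. unfold cos_num. rewrite (I_sym k j). ring. Qed.

Ltac trig_ring r i j k :=
  unfold gram, cos_num, sn2_side, cs_side;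
  rewrite ?(I_sym j i), ?(I_sym k i), ?(I_sym k j);
  ring [(cs_sqr T (r i)) (cs_sqr T (r j)) (cs_sqr T (r k))].

Lemma curv_sn2_side r i j : curv T * sn2_side r i j = cs_side r i j * cs_side r i j - 1.
Proof. trig_ring r i j j. Qed.

Lemma curv_cos_num r i j k :
  curv T * cos_num r i j k = cs_side r i j * cs_side r i k - cs_side r j k.
Proof. trig_ring r i j k. Qed.

Lemma cos_num_projection r i j k :
  cs_side r i j * cos_num r i j k + cos_num r j i k = cs_side r i k * sn2_side r i j.
Proof. trig_ring r i j k. Qed.

Lemma gram_swap r i j k : gram r i j k = gram r j i k.
Proof. trig_ring r i j k. Qed.

Lemma cos_num_polar r i j k :
  cos_num r i j k * cos_num r j i k + cos_num r k i j * sn2_side r i j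
  = cs_side r i j * gram r i j k.
Proof.
  pose proof (cos_num_projection r i j k) as Hij. pose proof (cos_num_projection r i k j) as Hik.
  rewrite (cos_num_swap r i k j) in Hik. unfold gram. nsatz.
Qed.

Lemma gram_swap_right r i j k : gram r i k j = gram r i j k.
Proof. unfold gram. rewrite (cos_num_swap r i k j). ring. Qed.

Lemma curv_gram r i j k :
  curv T * gram r i j k
  = cs_side r i j * cos_num r k i j + cs_side r j k * cos_num r i j k - sn2_side r i k.
Proof.
  pose proof (cos_num_projection r i k j) as H. rewrite (cos_num_swap r i k j) in H.
  transitivity (curv T * sn2_side r i j * sn2_side r i k
    - cos_num r i j k * (curv T * cos_num r i j k)); [unfold gram; ring|].
  rewrite curv_sn2_side, curv_cos_num.
  apply Rminus_diag_uniq. apply Rminus_diag_eq in H.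
  transitivity (- cs_side r i j * (cs_side r i k * cos_num r i j k + cos_num r k i j
    - cs_side r i j * sn2_side r i k)); [ring|]. rewrite H. ring.
Qed.

Lemma gram_cyclic r i j k :
  sn2_side r i j * sn2_side r j k - cos_num r j i k * cos_num r j i k = gram r i j k /\
  sn2_side r i k * sn2_side r j k - cos_num r k i j * cos_num r k i j = gram r i j k.
Proof.
  split.
  - rewrite gram_swap. unfold gram. now rewrite (sn2_side_sym r j i).
  - rewrite <- gram_swap_right, gram_swap. unfold gram.
    now rewrite (sn2_side_sym r k i), (sn2_side_sym r k j).
Qed.

Lemma cos_num_polar_cyclic r i j k :
  cos_num r i j k * cos_num r j i k + cos_num r k i j * sn2_side r i j
    = cs_side r i j * gram r i j k /\
  cos_num r i j k * cos_num r k i j + cos_num r j i k * sn2_side r i k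
    = cs_side r i k * gram r i j k /\
  cos_num r j i k * cos_num r k i j + cos_num r i j k * sn2_side r j k
    = cs_side r j k * gram r i j k.
Proof.
  split; [apply cos_num_polar|]. split.
  - pose proof (cos_num_polar r i k j) as H.
    now rewrite gram_swap_right, (cos_num_swap r i k j) in H.
  - pose proof (cos_num_polar r j k i) as H.
    rewrite gram_swap_right, <- gram_swap, (cos_num_swap r j k i), (cos_num_swap r k j i) in H.
    exact H.
Qed.

(* Up to the factor [sn (r i)], the derivative of [r i |-> sn2_side r i j / 2], divided by
   [cs_side r i j]. *)
Definition dside (r : vec) (i j : nat) : R :=
  sn T (r i) * (sn T (r i) * cs T (r j) + I i j * cs T (r i) * sn T (r j)).

(* In the Euclidean plane: the fraction of the side [i j], measured from [i], that is cut off by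
   the radical axis of the circles [i] and [j]. *)
Definition foot (r : vec) (i j : nat) : R := dside r i j / sn2_side r i j.

(* [v] is a tangent vector in the coordinates [u] with [d u_i = d r_i / sn r_i]. *)
Definition side_var (r v : vec) (i j : nat) : R := foot r i j * v i + foot r j i * v j.

Lemma dside_side_var r v i j : sn2_side r i j <> 0 ->
  dside r i j * v i + dside r j i * v j = sn2_side r i j * side_var r v i j.
Proof. intros H. unfold side_var, foot. rewrite (sn2_side_sym r j i). field. assumption. Qed.

(* Minus [sqrt (gram r i j k)] times the first variation of [angle r i j k]; see [angle_derive]. *)
Definition angle_var (r v : vec) (i j k : nat) : R :=
  cos_num r j i k * side_var r v i j + cos_num r k i j * side_var r v i k
  - sn2_side r j k * side_var r v j k.

Definition own (r : vec) (i j k : nat) : R :=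
  foot r i j * cos_num r j i k + foot r i k * cos_num r k i j.

Definition cross (r : vec) (i j k : nat) : R :=
  foot r j i * cos_num r j i k - foot r j k * sn2_side r j k.

Lemma angle_var_expand r v i j k :
  angle_var r v i j k = own r i j k * v i + cross r i j k * v j + cross r i k j * v k.
Proof.
  unfold angle_var, own, cross, side_var. rewrite (sn2_side_sym r k j). ring.
Qed.

Definition proper (r : vec) (i j k : nat) : Prop :=
  (0 < r i /\ 0 < r j /\ 0 < r k) /\ (0 <= I i j /\ 0 <= I i k /\ 0 <= I j k) /\
  0 < gram r i j k.

Lemma proper_swap r i j k : proper r i j k -> proper r j i k.
Proof. unfold proper. rewrite (I_sym j i), <- gram_swap. tauto. Qed.

Lemma proper_swap_right r i j k : proper r i j k -> proper r i k j.
Proof. unfold proper. rewrite (I_sym k j), gram_swap_right. tauto. Qed.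

Lemma sn2_side_pos r i j : 0 < r i -> 0 < r j -> 0 <= I i j -> 0 < sn2_side r i j.
Proof.
  intros Hi Hj HI. apply (sn_pos T) in Hi. apply (sn_pos T) in Hj.
  pose proof (cs_pos T (r i)). pose proof (cs_pos T (r j)). pose proof (curv_nonneg T).
  unfold sn2_side.
  assert (0 < sn T (r i) * sn T (r i)) by now apply Rmult_lt_0_compat.
  assert (0 < sn T (r j) * sn T (r j)) by now apply Rmult_lt_0_compat.
  assert (0 <= 2 * I i j * sn T (r i) * sn T (r j) * cs T (r i) * cs T (r j))
    by (repeat apply Rmult_le_pos; lra).
  assert (0 <= curv T * (1 + I i j * I i j) * sn T (r i) * sn T (r i) * sn T (r j) * sn T (r j))
    by (repeat apply Rmult_le_pos; try lra; nra).
  lra.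
Qed.

Lemma cs_side_ge_1 r i j : 0 < r i -> 0 < r j -> 0 <= I i j -> 1 <= cs_side r i j.
Proof.
  intros Hi Hj HI. pose proof (sn2_side_pos r i j Hi Hj HI).
  pose proof (Rmult_le_pos _ _ (curv_nonneg T) (Rlt_le _ _ H)) as Hk. rewrite curv_sn2_side in Hk.
  assert (0 < cs_side r i j); [|nra].
  apply (sn_pos T) in Hi. apply (sn_pos T) in Hj. pose proof (curv_nonneg T).
  pose proof (Rmult_lt_0_compat _ _ (cs_pos T (r i)) (cs_pos T (r j))).
  assert (0 <= curv T * I i j * sn T (r i) * sn T (r j)) by (repeat apply Rmult_le_pos; lra).
  unfold cs_side. lra.
Qed.

Lemma foot_pos r i j : 0 < r i -> 0 < r j -> 0 <= I i j -> 0 < foot r i j.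
Proof.
  intros Hi Hj HI. apply Rdiv_lt_0_compat; [|now apply sn2_side_pos].
  apply (sn_pos T) in Hi. apply (sn_pos T) in Hj.
  pose proof (cs_pos T (r i)). pose proof (cs_pos T (r j)).
  assert (0 < sn T (r i) * cs T (r j)) by now apply Rmult_lt_0_compat.
  assert (0 <= I i j * cs T (r i) * sn T (r j)) by (repeat apply Rmult_le_pos; lra).
  apply Rmult_lt_0_compat; lra.
Qed.

Lemma cross_sym r i j k : proper r i j k -> cross r i j k = cross r j i k.
Proof.
  intros ((Hi & Hj & Hk) & (Hij & Hik & Hjk) & _).
  assert (E : dside r j i * cos_num r j i k - dside r j k * sn2_side r i j
            = dside r i j * cos_num r i j k - dside r i k * sn2_side r i j)
    by (unfold dside; trig_ring r i j k).
  pose proof (sn2_side_pos r i j Hi Hj Hij). pose proof (sn2_side_pos r i k Hi Hk Hik).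
  pose proof (sn2_side_pos r j k Hj Hk Hjk).
  unfold cross, foot. rewrite (sn2_side_sym r j i).
  apply Rmult_eq_reg_r with (sn2_side r i j); [|lra].
  transitivity (dside r j i * cos_num r j i k - dside r j k * sn2_side r i j); [field; lra|].
  rewrite E. field. lra.
Qed.

Definition minor (r : vec) (i j k : nat) : R :=
  own r i j k * own r j i k - cross r i j k * cross r j i k.

Lemma minor_eq r i j k :
  minor r i j k = gram r i j k *
    (cs_side r i k * foot r i k * foot r j i + cs_side r j k * foot r j k * foot r i j
     - foot r i k * foot r j k).
Proof.
  destruct (cos_num_polar_cyclic r i j k) as (_ & Hik & Hjk).
  destruct (gram_cyclic r i j k) as [_ Hk].
  unfold minor, own, cross. rewrite (cos_num_swap r k j i).
  transitivity (
    foot r i j * foot r j k * (cos_num r j i k * cos_num r k i j + cos_num r i j k * sn2_side r j k)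
    + foot r i k * foot r j i
      * (cos_num r i j k * cos_num r k i j + cos_num r j i k * sn2_side r i k)
    - foot r i k * foot r j k
      * (sn2_side r i k * sn2_side r j k - cos_num r k i j * cos_num r k i j)).
  - ring.
  - rewrite Hik, Hjk, Hk. ring.
Qed.

(* The Jacobian of the three angles is [A] times the matrix of the [foot]s, where the rows of [A]
   are the coefficients of [side_var] in [angle_var]; this is why its determinant splits. *)
Lemma angle_var_det r i j k :
  proper r i j k ->
  det3 (own r i j k) (cross r i j k) (cross r i k j) (own r j i k) (cross r j k i) (own r k i j)
  = curv T * (gram r i j k * gram r i j k
    * (foot r i j * foot r j k * foot r k i + foot r i k * foot r j i * foot r k j)).
Proof.
  intros H. pose proof (cross_sym r i j k H) as Sij.
  pose proof (cross_sym r i k j (proper_swap_right _ _ _ _ H)) as Sik.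
  pose proof (cross_sym r j k i (proper_swap_right _ _ _ _ (proper_swap _ _ _ _ H))) as Sjk.
  destruct (cos_num_polar_cyclic r i j k) as (Hij & Hik & Hjk).
  destruct (gram_cyclic r i j k) as [Hj _].
  assert (HdetA :
    cos_num r k i j * (cos_num r i j k * cos_num r j i k + cos_num r k i j * sn2_side r i j)
    - sn2_side r i k * (sn2_side r i j * sn2_side r j k - cos_num r j i k * cos_num r j i k)
    + cos_num r i j k * (cos_num r j i k * cos_num r k i j + cos_num r i j k * sn2_side r j k)
    = curv T * (gram r i j k * gram r i j k)).
  { rewrite Hij, Hjk, Hj, <- (Rmult_assoc (curv T)), curv_gram. ring. }
  rewrite <- Rmult_assoc, <- HdetA.
  transitivity (own r i j k * (own r j i k * own r k i j - cross r j k i * cross r k j i)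
    - cross r i j k * (cross r j i k * own r k i j - cross r j k i * cross r k i j)
    + cross r i k j * (cross r j i k * cross r k j i - own r j i k * cross r k i j)).
  - unfold det3. rewrite <- Sij, <- Sik, <- Sjk. ring.
  - unfold own, cross.
    rewrite (cos_num_swap r i k j), (cos_num_swap r j k i), (cos_num_swap r k j i).
    rewrite (sn2_side_sym r j i), (sn2_side_sym r k i), (sn2_side_sym r k j). ring.
Qed.

Lemma proper_foot_pos r i j k : proper r i j k ->
  0 < foot r i j /\ 0 < foot r j i /\ 0 < foot r i k /\ 0 < foot r k i /\
  0 < foot r j k /\ 0 < foot r k j.
Proof.
  intros (Hr & (Hij & Hik & Hjk) & _). repeat split; apply foot_pos; try apply Hr;
    rewrite ?(I_sym j i), ?(I_sym k i), ?(I_sym k j); assumption.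
Qed.

Lemma minor_pos_or r i j k : proper r i j k -> 0 < minor r i j k \/ 0 < minor r i k j.
Proof.
  intros H. destruct (proper_foot_pos r i j k H) as (Fij & Fji & Fik & Fki & Fjk & Fkj).
  destruct H as ((Hi & Hj & Hk) & (Hij & Hik & Hjk) & Hgram).
  pose proof (cs_side_ge_1 r i j Hi Hj Hij) as Lij.
  pose proof (cs_side_ge_1 r i k Hi Hk Hik) as Lik.
  pose proof (cs_side_ge_1 r j k Hj Hk Hjk) as Ljk.
  rewrite !minor_eq, (gram_swap_right r i j k), (cs_side_sym r k j).
  assert (Hlarger : forall a b c d x y l, 0 < a -> 0 < b -> 0 < c -> 0 < x <= y -> 1 <= l ->
    0 < d -> 0 < d * (a * x * b + l * c * y - x * c)).
  { intros a b c d x y l Ha Hb Hc Hxy Hl Hd. apply Rmult_lt_0_compat; [assumption|].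
    assert (0 < a * x * b) by (repeat apply Rmult_lt_0_compat; lra).
    assert (x * c <= l * y * c) by (apply Rmult_le_compat_r; nra). lra. }
  destruct (Rle_lt_dec (foot r i k) (foot r i j)); [left|right]; apply Hlarger; try split; lra.
Qed.

Lemma cos_num_pos_or r i j k : proper r i j k -> 0 < cos_num r i j k \/ 0 < cos_num r j i k.
Proof.
  intros ((Hi & Hj & Hk) & (Hij & Hik & Hjk) & _).
  pose proof (cs_side_ge_1 r i j Hi Hj Hij). pose proof (cs_side_ge_1 r i k Hi Hk Hik).
  pose proof (Rmult_lt_0_compat (cs_side r i k) _ ltac:(lra) (sn2_side_pos r i j Hi Hj Hij))
    as Hpos.
  rewrite <- cos_num_projection in Hpos.
  destruct (Rlt_le_dec 0 (cos_num r i j k)) as [|Hle]; [now left|right]. nra.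
Qed.

Lemma own_swap r i j k : own r i k j = own r i j k.
Proof. unfold own. ring. Qed.

Lemma own_pos_of_minor r i j k :
  proper r i j k -> 0 < minor r i j k -> 0 < own r j i k -> 0 < own r i j k.
Proof.
  intros H Hm Hj. unfold minor in Hm. rewrite (cross_sym r i j k H) in Hm.
  pose proof (Rle_0_sqr (cross r j i k)) as Hsqr. unfold Rsqr in Hsqr.
  apply Rmult_lt_reg_r with (own r j i k); [assumption|]. lra.
Qed.

Lemma minor_swap r i j k : minor r j i k = minor r i j k.
Proof. unfold minor. ring. Qed.

Lemma own_pos_transfer r i j k : proper r i j k -> 0 < own r j i k -> 0 < own r i j k.
Proof.
  intros H Hj. pose proof (proper_swap_right _ _ _ _ H) as Hikj.
  pose proof (proper_swap_right _ _ _ _ (proper_swap _ _ _ _ H)) as Hjki.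
  destruct (minor_pos_or r i j k H) as [Mij|Mik].
  - now apply own_pos_of_minor.
  - destruct (minor_pos_or r j k i Hjki) as [Mjk|Mji].
    + rewrite <- own_swap. apply own_pos_of_minor; [assumption|assumption|].
      rewrite own_swap. apply own_pos_of_minor.
      * now apply proper_swap.
      * now rewrite minor_swap.
      * now rewrite own_swap.
    + rewrite minor_swap in Mji. now apply own_pos_of_minor.
Qed.

(* At most one of the three angles is obtuse, so one of the diagonal entries is positive; the
   positive minors propagate the sign to the other two. *)
Lemma own_pos r i j k : proper r i j k -> 0 < own r i j k.
Proof.
  assert (Hacute : forall i j k, proper r i j k -> 0 < cos_num r j i k -> 0 < cos_num r k i j ->
    0 < own r i j k).
  { intros a b c ((Ha & Hb & Hc) & (Hab & Hac & _) & _) Nb Nc.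
    apply Rplus_lt_0_compat; apply Rmult_lt_0_compat; try assumption; now apply foot_pos. }
  intros H. pose proof (proper_swap _ _ _ _ H) as Hjik.
  pose proof (proper_swap_right _ _ _ _ H) as Hikj. pose proof (proper_swap _ _ _ _ Hikj) as Hkij.
  destruct (Rlt_le_dec 0 (cos_num r j i k)) as [Nj|Nj];
    [destruct (Rlt_le_dec 0 (cos_num r k i j)) as [Nk|Nk]; [now apply Hacute|]|].
  - destruct (cos_num_pos_or r k i j Hkij) as [|Ni]; [lra|].
    rewrite <- own_swap. apply own_pos_transfer; [assumption|].
    apply Hacute; [assumption|assumption|].
    now rewrite cos_num_swap.
  - destruct (cos_num_pos_or r j i k Hjik) as [|Ni]; [lra|].
    destruct (cos_num_pos_or r j k i (proper_swap_right _ _ _ _ Hjik)) as [Nj'|Nk].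
    + rewrite cos_num_swap in Nj'. lra.
    + apply own_pos_transfer; [assumption|]. now apply Hacute.
Qed.

Definition tri_form (r v : vec) (i j k : nat) : R :=
  v i * angle_var r v i j k + v j * angle_var r v j i k + v k * angle_var r v k i j.

Lemma angle_var_swap r v i j k : angle_var r v i k j = angle_var r v i j k.
Proof. unfold angle_var. rewrite (sn2_side_sym r k j). unfold side_var. ring. Qed.

Lemma tri_form_swap r v i j k : tri_form r v j i k = tri_form r v i j k.
Proof. unfold tri_form. rewrite (angle_var_swap r v k i j). ring. Qed.

Lemma angle_var_det_pos r i j k : proper r i j k ->
  0 < gram r i j k * gram r i j k
    * (foot r i j * foot r j k * foot r k i + foot r i k * foot r j i * foot r k j).
Proof.
  intros H. destruct (proper_foot_pos r i j k H) as (Fij & Fji & Fik & Fki & Fjk & Fkj).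
  destruct H as (_ & _ & Hgram).
  apply Rmult_lt_0_compat; [now apply Rmult_lt_0_compat|].
  apply Rplus_lt_0_compat; (apply Rmult_lt_0_compat; [now apply Rmult_lt_0_compat|assumption]).
Qed.

Theorem tri_form_semidefinite r v i j k :
  proper r i j k -> 0 <= tri_form r v i j k /\
  (tri_form r v i j k = 0 ->
   angle_var r v i j k = 0 /\ angle_var r v j i k = 0 /\ angle_var r v k i j = 0).
Proof.
  assert (Hminor : forall i j k, proper r i j k -> 0 < minor r k i j ->
    0 <= tri_form r v i j k /\ (tri_form r v i j k = 0 ->
    angle_var r v i j k = 0 /\ angle_var r v j i k = 0 /\ angle_var r v k i j = 0)).
  { intros a b c H Hm. pose proof (proper_swap_right _ _ _ _ H) as Hacb.
    pose proof (proper_swap_right _ _ _ _ (proper_swap _ _ _ _ H)) as Hbca.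
    unfold tri_form. rewrite !angle_var_expand.
    rewrite <- (cross_sym r a b c H), <- (cross_sym r a c b Hacb), <- (cross_sym r b c a Hbca).
    rewrite (Rplus_comm (own r b a c * v b)), (Rplus_comm _ (cross r b c a * v b)).
    destruct (form3_semidefinite (own r a b c) (cross r a b c) (cross r a c b) (own r b a c)
      (cross r b c a) (own r c a b) (v a) (v b) (v c)) as [Hpos Hzero].
    - apply own_pos. now apply proper_swap.
    - unfold minor in Hm. rewrite <- (cross_sym r a c b Hacb), (own_swap r a b c) in Hm. lra.
    - rewrite angle_var_det by assumption. apply Rmult_le_pos; [apply curv_nonneg|].
      left. now apply angle_var_det_pos.
    - unfold form3 in *. split.
      + eapply Rle_trans; [exact Hpos|]. right. ring.
      + intros E. destruct Hzero as (Za & Zb & Zc); [rewrite <- E; ring|].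
        repeat split; lra. }
  intros H. pose proof (proper_swap_right _ _ _ _ (proper_swap _ _ _ _ H)) as Hjki.
  destruct (minor_pos_or r k i j) as [Mi|Mj]; [now apply proper_swap, proper_swap_right| |].
  - now apply Hminor.
  - destruct (Hminor j i k (proper_swap _ _ _ _ H) Mj) as [Hpos Hzero].
    rewrite tri_form_swap in Hpos, Hzero. split; [assumption|]. intros E.
    destruct (Hzero E) as (Zj & Zi & Zk). rewrite (angle_var_swap r v k j i). tauto.
Qed.

Lemma cs_one : curv T = 0 -> forall x, cs T x = 1.
Proof.
  intros H x. pose proof (cs_sqr T x) as E. rewrite H in E. pose proof (cs_pos T x). nra.
Qed.

Lemma flat_cs_side r i j : curv T = 0 -> cs_side r i j = 1.
Proof. intros H. unfold cs_side. rewrite !cs_one, H by assumption. ring. Qed.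

Lemma flat_foot_sum r i j :
  curv T = 0 -> 0 < r i -> 0 < r j -> 0 <= I i j -> foot r i j + foot r j i = 1.
Proof.
  intros H Hi Hj HI. pose proof (sn2_side_pos r i j Hi Hj HI) as Hpos.
  unfold foot. rewrite (sn2_side_sym r j i). rewrite <- Rdiv_plus_distr.
  replace (dside r i j + dside r j i) with (sn2_side r i j); [field; lra|].
  unfold dside, sn2_side. rewrite !cs_one, H, (I_sym j i) by assumption. ring.
Qed.

(* Scaling all radii does not change the angles of a Euclidean triangle. *)
Lemma flat_angle_var_const r i j k :
  curv T = 0 -> proper r i j k -> own r i j k + cross r i j k + cross r i k j = 0.
Proof.
  intros H ((Hi & Hj & Hk) & (Hij & Hik & Hjk) & _).
  transitivity (angle_var r (fun _ => 1) i j k); [rewrite angle_var_expand; ring|].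
  unfold angle_var, side_var. rewrite !Rmult_1_r, !flat_foot_sum, !Rmult_1_r by assumption.
  pose proof (cos_num_projection r j k i) as E.
  rewrite !flat_cs_side, (cos_num_swap r j k i), (cos_num_swap r k j i) in E by assumption. lra.
Qed.

Lemma flat_angle_var_kernel r v i j k :
  curv T = 0 -> proper r i j k -> 0 < minor r i j k ->
  angle_var r v i j k = 0 -> angle_var r v j i k = 0 -> v i = v k /\ v j = v k.
Proof.
  intros Hflat H Hm. pose proof (flat_angle_var_const r i j k Hflat H) as Ci.
  pose proof (flat_angle_var_const r j i k Hflat (proper_swap _ _ _ _ H)) as Cj.
  rewrite !angle_var_expand. unfold minor in Hm. intros Ei Ej.
  assert (Hzero : forall x, (own r i j k * own r j i k - cross r i j k * cross r j i k) * x = 0 ->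
    x = 0) by (intros x Hx; apply Rmult_integral in Hx; lra).
  split; apply Rminus_diag_uniq, Hzero; clear Hzero Hm; nsatz.
Qed.

Theorem angle_var_kernel r v i j k :
  proper r i j k ->
  angle_var r v i j k = 0 -> angle_var r v j i k = 0 -> angle_var r v k i j = 0 ->
  (v i = v j /\ v i = v k) /\ curv T * v i = 0.
Proof.
  intros H Ei Ej Ek. pose proof (proper_swap_right _ _ _ _ H) as Hikj.
  pose proof (proper_swap_right _ _ _ _ (proper_swap _ _ _ _ H)) as Hjki.
  destruct (Rle_lt_or_eq_dec _ _ (curv_nonneg T)) as [Hcurv|Hflat].
  - rewrite angle_var_expand in Ei, Ej, Ek.
    rewrite <- (cross_sym r i j k H) in Ej.
    rewrite <- (cross_sym r i k j Hikj), <- (cross_sym r j k i Hjki) in Ek.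
    destruct (det3_kernel (own r i j k) (cross r i j k) (cross r i k j) (own r j i k)
      (cross r j k i) (own r k i j) (v i) (v j) (v k)) as (Zi & Zj & Zk); try lra.
    + rewrite angle_var_det by assumption.
      apply Rgt_not_eq, Rmult_lt_0_compat; [assumption|now apply angle_var_det_pos].
    + rewrite Zi, Zj, Zk. repeat split; ring.
  - symmetry in Hflat. rewrite Hflat. split; [|ring].
    destruct (minor_pos_or r i j k H) as [Mij|Mik].
    + destruct (flat_angle_var_kernel r v i j k Hflat H Mij Ei Ej). split; congruence.
    + rewrite <- angle_var_swap in Ei.
      destruct (flat_angle_var_kernel r v i k j Hflat Hikj Mik Ei Ek). split; congruence.
Qed.

Lemma cos_ratio_bound r i j k :
  proper r i j k ->
  0 < sqrt (sn2_side r i j) * sqrt (sn2_side r i k) /\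
  -1 < cos_num r i j k / (sqrt (sn2_side r i j) * sqrt (sn2_side r i k)) < 1 /\
  sqrt (sn2_side r i j) * sqrt (sn2_side r i k) * (sqrt (sn2_side r i j) * sqrt (sn2_side r i k))
  = sn2_side r i j * sn2_side r i k.
Proof.
  intros ((Hi & Hj & Hk) & (Hij & Hik & Hjk) & Hgram).
  pose proof (sn2_side_pos r i j Hi Hj Hij) as Pij.
  pose proof (sn2_side_pos r i k Hi Hk Hik) as Pik.
  pose proof (sqrt_lt_R0 _ Pij). pose proof (sqrt_lt_R0 _ Pik).
  assert (Hpos : 0 < sqrt (sn2_side r i j) * sqrt (sn2_side r i k)) by now apply Rmult_lt_0_compat.
  assert (Hsqr : sqrt (sn2_side r i j) * sqrt (sn2_side r i k)
     * (sqrt (sn2_side r i j) * sqrt (sn2_side r i k)) = sn2_side r i j * sn2_side r i k).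
  { rewrite <- (sqrt_sqrt (sn2_side r i j)), <- (sqrt_sqrt (sn2_side r i k)) at 3; lra. }
  split; [assumption|]. split; [|assumption].
  apply sqr_lt_ratio_lt_1; [assumption|]. rewrite Hsqr. unfold gram in Hgram. lra.
Qed.

(** * The first variation of the angles *)

Section First_variation.

Variables (gamma : R -> vec) (t : R) (v : vec).
Hypothesis gamma_derive :
  forall i, is_derive (fun s => gamma s i) t (sn T (gamma t i) * v i).

Ltac derive_radii :=
  lazymatch goal with
  | |- is_derive (fun s => @?f s + @?g s) _ _ => apply (is_derive_Rplus f g); derive_radii
  | |- is_derive (fun s => @?f s - @?g s) _ _ => apply (is_derive_Rminus f g); derive_radii
  | |- is_derive (fun s => @?f s * @?g s) _ _ => apply (is_derive_Rmult f g); derive_radii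
  | |- is_derive (fun s => sn T (@?f s)) _ _ =>
      apply (is_derive_Rcomp (sn T) f); [apply is_derive_sn|derive_radii]
  | |- is_derive (fun s => cs T (@?f s)) _ _ =>
      apply (is_derive_Rcomp (cs T) f); [apply is_derive_cs|derive_radii]
  | |- is_derive (fun _ => ?c) _ _ => apply (is_derive_Rconst c)
  | _ => apply gamma_derive
  end.

Lemma sn2_side_derive i j :
  is_derive (fun s => sn2_side (gamma s) i j) t
    (2 * cs_side (gamma t) i j * (dside (gamma t) i j * v i + dside (gamma t) j i * v j)).
Proof.
  unfold sn2_side. eapply is_derive_eq; [derive_radii|].
  unfold dside. trig_ring (gamma t) i j j.
Qed.

Lemma cos_num_derive i j k :
  is_derive (fun s => cos_num (gamma s) i j k) t
    (cs_side (gamma t) i k * (dside (gamma t) i j * v i + dside (gamma t) j i * v j)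
     + cs_side (gamma t) i j * (dside (gamma t) i k * v i + dside (gamma t) k i * v k)
     - (dside (gamma t) j k * v j + dside (gamma t) k j * v k)).
Proof.
  unfold cos_num. eapply is_derive_eq; [derive_radii|].
  unfold dside. trig_ring (gamma t) i j k.
Qed.

Theorem angle_derive i j k :
  proper (gamma t) i j k ->
  is_derive (fun s => angle (gamma s) i j k) t
    (- angle_var (gamma t) v i j k / sqrt (gram (gamma t) i j k)).
Proof.
  set (r := gamma t). intros H. destruct (cos_ratio_bound r i j k H) as (Hd & _ & Sd).
  destruct H as ((Hi & Hj & Hk) & (Hij & Hik & Hjk) & Hgram).
  pose proof (sn2_side_pos r i j Hi Hj Hij) as Pij.
  pose proof (sn2_side_pos r i k Hi Hk Hik) as Pik.
  pose proof (sn2_side_pos r j k Hj Hk Hjk) as Pjk.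
  pose proof (sqrt_sqrt _ (Rlt_le _ _ Pij)) as Sij.
  pose proof (sqrt_sqrt _ (Rlt_le _ _ Pik)) as Sik.
  eapply is_derive_eq.
  - apply (is_derive_acos_div (fun s => cos_num (gamma s) i j k)
      (fun s => sqrt (sn2_side (gamma s) i j) * sqrt (sn2_side (gamma s) i k))).
    + apply cos_num_derive.
    + apply is_derive_Rmult; apply is_derive_sqrt; auto; apply sn2_side_derive.
    + assumption.
    + fold r. rewrite Sd. unfold gram in Hgram. lra.
  - cbv beta. fold r. rewrite Sd. fold (gram r i j k). f_equal. f_equal.
    rewrite !(Rmult_assoc 2), !dside_side_var by lra.
    set (rho := sqrt (sn2_side r i j)) in *. set (rho' := sqrt (sn2_side r i k)) in *.
    transitivity (cs_side r i k * (sn2_side r i j * side_var r v i j)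
      + cs_side r i j * (sn2_side r i k * side_var r v i k) - sn2_side r j k * side_var r v j k
      - cos_num r i j k * (cs_side r i j * side_var r v i j + cs_side r i k * side_var r v i k)).
    + f_equal. unfold Rdiv. rewrite Rmult_assoc. f_equal. rewrite <- Sij, <- Sik at 1.
      assert (rho <> 0 /\ rho' <> 0) by (split; intros Z; rewrite Z in Hd; lra). field. tauto.
    + pose proof (cos_num_projection r i j k) as Ej. pose proof (cos_num_projection r i k j) as Ek.
      rewrite (cos_num_swap r i k j) in Ek. unfold angle_var.
      transitivity (
       (cs_side r i k * sn2_side r i j - cs_side r i j * cos_num r i j k) * side_var r v i j
       + (cs_side r i j * sn2_side r i k - cs_side r i k * cos_num r i j k) * side_var r v i k
       - sn2_side r j k * side_var r v j k); [ring|].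
      rewrite <- Ej, <- Ek. ring.
Qed.

End First_variation.

Lemma Ck_sn2_side n k U i j :
  open_n n U -> (i < n)%nat -> (j < n)%nat -> Ck n k U (fun r => sn2_side r i j).
Proof.
  intros HU Hi Hj. unfold sn2_side.
  repeat first [apply Ck_plus | apply Ck_mult | apply Ck_const | now apply Ck_sn | now apply Ck_cs].
Qed.

Lemma angle_smooth n U i j k :
  open_n n U -> (i < n)%nat -> (j < n)%nat -> (k < n)%nat ->
  (forall r, U r -> proper r i j k) -> smooth_on n U (fun r => angle r i j k).
Proof.
  intros HU Hi Hj Hk Hok m.
  assert (Hpos : forall r, U r -> 0 < sn2_side r i j /\ 0 < sn2_side r i k)
    by (intros r Ur; destruct (Hok r Ur) as ((? & ? & ?) & (? & ? & ?) & _);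
        split; now apply sn2_side_pos).
  apply Ck_acos; [assumption| |intros r Ur; now apply cos_ratio_bound, Hok].
  apply Ck_div; [assumption| | |intros r Ur; now apply Rgt_not_eq, cos_ratio_bound, Hok].
  - unfold cos_num. repeat first [apply Ck_plus | apply Ck_minus | apply Ck_mult
      | apply Ck_const | now apply Ck_sn | now apply Ck_cs].
  - apply Ck_mult; (apply Ck_sqrt; [assumption|now apply Ck_sn2_side|apply Hpos]).
Qed.

Lemma cos_angle r i j k : proper r i j k ->
  cos (angle r i j k) = cos_num r i j k / (sqrt (sn2_side r i j) * sqrt (sn2_side r i k)).
Proof. intros H. apply cos_acos. destruct (cos_ratio_bound r i j k H) as (_ & Hb & _). lra. Qed.

Lemma sin_angle r i j k : proper r i j k ->
  sin (angle r i j k) = sqrt (gram r i j k) / (sqrt (sn2_side r i j) * sqrt (sn2_side r i k)).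
Proof.
  intros H. destruct (cos_ratio_bound r i j k H) as (Hd & Hb & Hsqr).
  destruct H as (_ & _ & Hgram). unfold angle. rewrite sin_acos by lra.
  set (d := sqrt (sn2_side r i j) * sqrt (sn2_side r i k)) in *.
  replace (1 - (cos_num r i j k / d)²) with (gram r i j k / (d * d))
    by (unfold gram, Rsqr; rewrite <- Hsqr; field; lra).
  rewrite sqrt_div by nra. now rewrite sqrt_square by lra.
Qed.

Lemma angle_range r i j k : proper r i j k -> 0 <= angle r i j k <= PI /\ 0 < sin (angle r i j k).
Proof.
  intros H. split; [apply acos_bound|]. rewrite sin_angle by assumption.
  apply Rdiv_lt_0_compat; [apply sqrt_lt_R0, H|now apply cos_ratio_bound].
Qed.

Lemma flat_angle_pair r i j k : curv T = 0 -> proper r i j k ->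
  cos (angle r i j k + angle r j i k) = - cos (angle r k i j) /\
  sin (angle r i j k + angle r j i k) = sin (angle r k i j).
Proof.
  intros Hflat H. pose proof (proper_swap _ _ _ _ H) as Hjik.
  pose proof (proper_swap _ _ _ _ (proper_swap_right _ _ _ _ H)) as Hkij.
  pose proof (cos_num_polar r i j k) as Hpol. pose proof (cos_num_projection r i j k) as Hproj.
  rewrite flat_cs_side in Hpol by assumption. rewrite !flat_cs_side in Hproj by assumption.
  rewrite cos_plus, sin_plus, !cos_angle, !sin_angle by assumption.
  rewrite <- (gram_swap r i j k), <- (gram_swap r i k j), (gram_swap_right r i j k).
  rewrite (sn2_side_sym r j i), (sn2_side_sym r k i), (sn2_side_sym r k j).
  destruct H as ((Hi & Hj & Hk) & (Hij & Hik & Hjk) & Hgram).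
  pose proof (sn2_side_pos r i j Hi Hj Hij) as Pij.
  pose proof (sqrt_sqrt _ (Rlt_le _ _ Pij)) as Sij. pose proof (sqrt_lt_R0 _ Pij) as Rij.
  pose proof (sqrt_lt_R0 _ (sn2_side_pos r i k Hi Hk Hik)) as Rik.
  pose proof (sqrt_lt_R0 _ (sn2_side_pos r j k Hj Hk Hjk)) as Rjk.
  pose proof (sqrt_sqrt _ (Rlt_le _ _ Hgram)) as Sg.
  set (a := sqrt (sn2_side r i j)) in *. set (b := sqrt (sn2_side r i k)) in *.
  set (c := sqrt (sn2_side r j k)) in *. set (g := sqrt (gram r i j k)) in *.
  clearbody a b c g. split.
  - transitivity ((cos_num r i j k * cos_num r j i k - g * g) / (a * a * (b * c))); [field; lra|].
    rewrite Sg, Sij.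
    replace (cos_num r i j k * cos_num r j i k - gram r i j k)
      with (- (cos_num r k i j * sn2_side r i j)) by lra.
    field. lra.
  - transitivity (g * (1 * cos_num r i j k + cos_num r j i k) / (a * a * (b * c))); [field; lra|].
    rewrite Hproj, Sij. field. lra.
Qed.

Theorem flat_angle_sum r i j k :
  curv T = 0 -> proper r i j k -> angle r i j k + angle r j i k + angle r k i j = PI.
Proof.
  intros Hflat H. destruct (flat_angle_pair r i j k Hflat H) as [Hcos Hsin].
  destruct (angle_range r i j k H) as [Bi _].
  destruct (angle_range r j i k (proper_swap _ _ _ _ H)) as [Bj _].
  destruct (angle_range r k i j (proper_swap _ _ _ _ (proper_swap_right _ _ _ _ H))) as [Bk Sk].
  assert (Hle : angle r i j k + angle r j i k <= PI).
  { apply Rnot_lt_le. intros Hgt. rewrite <- Hsin in Sk.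
    assert (sin (angle r i j k + angle r j i k) <= 0) by (apply sin_le_0; lra). lra. }
  rewrite <- (acos_cos (angle r i j k + angle r j i k)) by lra.
  rewrite Hcos, acos_opp, acos_cos by assumption. ring.
Qed.

(** * Cone angles *)

Record metric_laws (len : vec -> nat -> nat -> R) (ang : R -> R -> R -> R) : Prop := {
  len_sym : forall r i j, len r i j = len r j i;
  len_cont : forall n U i j, open_n n U -> (i < n)%nat -> (j < n)%nat -> 0 <= I i j ->
    (forall r, U r -> 0 < r i /\ 0 < r j) -> cont_on n U (fun r => len r i j);
  len_gram : forall r i j k, 0 < r i -> 0 < r j -> 0 < r k ->
    0 <= I i j -> 0 <= I i k -> 0 <= I j k ->
    len r i j < len r i k + len r j k -> len r i k < len r i j + len r j k ->
    len r j k < len r i j + len r i k -> 0 < gram r i j k;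
  law_of_cosines : forall r i j k, proper r i j k ->
    ang (len r i j) (len r i k) (len r j k) = angle r i j k
}.

Variables (len : vec -> nat -> nat -> R) (ang : R -> R -> R -> R).
Hypothesis laws : metric_laws len ang.
Variables (n : nat) (F : list tri).
Hypothesis F_surface : closed_tri_surface n F.
Hypothesis I_nonneg : forall i j, is_edge F i j -> 0 <= I i j.

Definition adm (r : vec) : Prop := admissible n F (len r) r.

Definition cone (r : vec) (i : nat) : R := cone_angle F ang (len r) i.

Lemma tri_vertices a b c : In (a, b, c) F ->
  (a < n)%nat /\ (b < n)%nat /\ (c < n)%nat /\ a <> b /\ b <> c /\ a <> c.
Proof. apply F_surface. Qed.

Lemma tri_weights a b c : In (a, b, c) F -> 0 <= I a b /\ 0 <= I a c /\ 0 <= I b c.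
Proof.
  intros H. destruct (tri_vertices a b c H) as (_ & _ & _ & Hab & Hbc & Hac).
  repeat split; apply I_nonneg; split; auto; exists (a, b, c); simpl; auto.
Qed.

Lemma adm_proper r a b c : adm r -> In (a, b, c) F -> proper r a b c.
Proof.
  intros [Hpos Htri] H. destruct (tri_vertices a b c H) as (Ha & Hb & Hc & _).
  destruct (tri_weights a b c H) as (Wab & Wac & Wbc).
  destruct (Htri a b c H) as (Htri_ab & Htri_bc & Htri_ca). rewrite (len_sym _ _ laws r c a) in *.
  repeat split; auto. apply (len_gram _ _ laws); auto; lra.
Qed.

Lemma adm_corner_proper r t i j k : adm r -> In t F -> corner t i j k -> proper r i j k.
Proof.
  destruct t as [[a b] c]. intros Hr Ht. pose proof (adm_proper r a b c Hr Ht) as H.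
  intros [E|[E|E]]; injection E as -> -> ->.
  - assumption.
  - now apply proper_swap.
  - now apply proper_swap, proper_swap_right.
Qed.

Lemma corner_lt t i j k : In t F -> corner t i j k -> (i < n)%nat /\ (j < n)%nat /\ (k < n)%nat.
Proof.
  destruct t as [[a b] c]. intros Ht. destruct (tri_vertices a b c Ht) as (Ha & Hb & Hc & _).
  intros [E|[E|E]]; injection E as -> -> ->; auto.
Qed.

Lemma open_positive : open_n n (fun r => forall i, (i < n)%nat -> 0 < r i).
Proof.
  intros r Hr. apply (filter_forall_lt (nbhds n r)). intros i Hi.
  exists (r i). split; [now apply Hr|]. intros y Hy. specialize (Hy i Hi).
  apply Rabs_def2 in Hy. lra.
Qed.

Lemma adm_open : open_n n adm.
Proof.
  set (pos := fun r : vec => forall i, (i < n)%nat -> 0 < r i).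
  set (ineq := fun (t : tri) r => let '(a, b, c) := t in
    len r a b < len r b c + len r c a /\ len r b c < len r c a + len r a b /\
    len r c a < len r a b + len r b c).
  apply (open_n_ext n (fun r => pos r /\ forall t, In t F -> ineq t r)).
  - intros r. split; intros (Hpos & HF); split; try assumption.
    + intros a b c Ht. exact (HF (a, b, c) Ht).
    + intros [[a b] c] Ht. exact (HF a b c Ht).
  - assert (Hcont : forall i j, (i < n)%nat -> (j < n)%nat -> 0 <= I i j ->
      cont_on n pos (fun r => len r i j))
      by (intros i j Hi Hj HI; apply (len_cont _ _ laws); auto using open_positive).
    apply open_n_forall_in; [exact open_positive|]. intros [[a b] c] Ht.
    destruct (tri_vertices a b c Ht) as (Ha & Hb & Hc & _).
    destruct (tri_weights a b c Ht) as (Wab & Wac & Wbc). rewrite (I_sym a c) in Wac.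
    apply (open_n_ext n (fun r => (pos r /\ len r a b < len r b c + len r c a) /\
      (pos r /\ len r b c < len r c a + len r a b) /\
      (pos r /\ len r c a < len r a b + len r b c))); [intros r; unfold ineq; tauto|].
    apply open_n_and; [|apply open_n_and]; apply open_n_lt; auto using open_positive, cont_on_plus.
Qed.

Lemma angle_at_vertex r t i : adm r -> In t F ->
  angle_at ang (len r) t i = at_vertex t i (angle r) 0.
Proof.
  intros Hr Ht.
  replace (angle_at ang (len r) t i)
    with (at_vertex t i (fun i j k => ang (len r i j) (len r i k) (len r j k)) 0)
    by now destruct t as [[a b] c].
  destruct (at_vertex_spec t i) as [(j & k & Hc & E)|E]; rewrite !E; [|reflexivity].
  apply (law_of_cosines _ _ laws). now apply adm_corner_proper with t.
Qed.

Lemma cone_eq r i : adm r -> cone r i = lsum F (fun t => at_vertex t i (angle r) 0).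
Proof. intros Hr. apply lsum_ext. intros t Ht. now apply angle_at_vertex. Qed.

Lemma cone_smooth : smooth_map_on n adm cone.
Proof.
  intros i Hi m. apply Ck_ext with (fun r => lsum F (fun t => at_vertex t i (angle r) 0)).
  - exact adm_open.
  - intros r Hr. symmetry. now apply cone_eq.
  - apply (Ck_lsum n m adm F (fun t r => at_vertex t i (angle r) 0)). intros t Ht.
    destruct (at_vertex_spec t i) as [(j & k & Hc & E)|E].
    + replace (fun r => at_vertex t i (angle r) 0) with (fun r => angle r i j k)
        by (extensionality r; now rewrite E).
      destruct (corner_lt t i j k Ht Hc) as (Hi' & Hj & Hk).
      apply angle_smooth; auto using adm_open. intros r Hr. now apply adm_corner_proper with t.
    + replace (fun r => at_vertex t i (angle r) 0) with (fun _ : vec => 0)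
        by (extensionality r; now rewrite E). apply Ck_const.
Qed.

Definition cone_var (r v : vec) (i : nat) : R :=
  lsum F (fun t => at_vertex t i (fun i j k => - angle_var r v i j k / sqrt (gram r i j k)) 0).

Lemma cone_derive r i j : adm r -> (j < n)%nat ->
  is_derive (fun s => cone (upd r j s) i) (r j)
    (cone_var r (fun l => kron j l / sn T (r j)) i).
Proof.
  intros Hr Hj. assert (Hsn : 0 < sn T (r j)) by (apply sn_pos, Hr, Hj).
  apply (is_derive_upd_ext n adm j (fun r => lsum F (fun t => at_vertex t i (angle r) 0))
    (fun r => cone r i)); [exact adm_open|assumption|intros; symmetry; now apply cone_eq|].
  apply (is_derive_lsum F (fun t s => at_vertex t i (angle (upd r j s)) 0)). intros t Ht.
  destruct (at_vertex_spec t i) as [(a & b & Hc & E)|E]; rewrite E.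
  - pose proof (adm_corner_proper r t i a b Hr Ht Hc) as Hok.
    pose proof (angle_derive (fun s => upd r j s) (r j) (fun l => kron j l / sn T (r j))) as D.
    cbv beta in D. rewrite upd_id in D.
    apply (is_derive_ext (fun s => angle (upd r j s) i a b)); [intros; now rewrite E|].
    apply D; [|assumption]. intros l.
    eapply is_derive_eq; [apply is_derive_upd|].
    destruct (Nat.eq_dec l j) as [->|Hn]; [rewrite kron_refl; field; lra|].
    rewrite !kron_neq by auto. field. lra.
  - apply (is_derive_ext (fun _ => 0)); [intros; now rewrite E|apply is_derive_Rconst].
Qed.

Lemma angle_var_ext r v w i j k :
  v i = w i -> v j = w j -> v k = w k -> angle_var r v i j k = angle_var r w i j k.
Proof. intros Ei Ej Ek. unfold angle_var, side_var. now rewrite Ei, Ej, Ek. Qed.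

Lemma angle_var_sumn m w (u : nat -> vec) r i j k :
  angle_var r (fun l => sumn m (fun p => w p * u p l)) i j k
  = sumn m (fun p => w p * angle_var r (u p) i j k).
Proof.
  rewrite angle_var_expand.
  rewrite (sumn_ext m (fun p => w p * angle_var r (u p) i j k) (fun p =>
    own r i j k * (w p * u p i) + cross r i j k * (w p * u p j) + cross r i k j * (w p * u p k)))
    by (intros; rewrite angle_var_expand; ring).
  now rewrite !sumn_plus, !sumn_scal.
Qed.

Lemma cone_jacobian_mulv r v i : adm r ->
  mulv n (fun i j => jacobian cone r i j * sn T (r j)) v i = cone_var r v i.
Proof.
  intros Hr.
  assert (Hv : forall l, (l < n)%nat ->
    sumn n (fun j => sn T (r j) * v j * (kron j l / sn T (r j))) = v l).
  { intros l Hl. rewrite (sumn_ext n _ (fun j => kron l j * v j)); [now apply sumn_kron|].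
    intros j Hj. rewrite kron_sym. field. now apply Rgt_not_eq, sn_pos, Hr. }
  unfold mulv.
  rewrite (sumn_ext n _ (fun j => lsum F (fun t => at_vertex t i (fun i a b =>
    sn T (r j) * v j
    * (- angle_var r (fun l => kron j l / sn T (r j)) i a b / sqrt (gram r i a b))) 0))).
  - rewrite sumn_lsum. apply lsum_ext. intros t Ht.
    destruct (at_vertex_spec t i) as [(a & b & Hc & E)|E].
    + rewrite E. destruct (corner_lt t i a b Ht Hc) as (Hi & Ha & Hb).
      rewrite <- (angle_var_ext r
        (fun l => sumn n (fun j => sn T (r j) * v j * (kron j l / sn T (r j)))) v)
        by now apply Hv.
      rewrite angle_var_sumn. unfold Rdiv. rewrite <- Ropp_mult_distr_l, Ropp_mult_distr_r.
      rewrite (Rmult_comm (sumn n _)), <- sumn_scal. apply sumn_ext. intros j Hj. rewrite E.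
      unfold Rdiv. ring.
    + rewrite E. apply sumn_zero. intros. now rewrite E.
  - intros j Hj. unfold jacobian. rewrite (partial_unique _ _ _ _ (cone_derive r i j Hr Hj)).
    rewrite Rmult_assoc, Rmult_comm. unfold cone_var. rewrite <- lsum_scal.
    apply lsum_ext. intros t Ht.
    destruct (at_vertex_spec t i) as [(a & b & Hc & E)|E]; rewrite !E; ring.
Qed.

Definition tri_energy (r v : vec) (t : tri) : R :=
  let '(a, b, c) := t in tri_form r v a b c / sqrt (gram r a b c).

Lemma cone_var_energy r v : adm r ->
  sumn n (fun i => v i * cone_var r v i) = - lsum F (tri_energy r v).
Proof.
  intros Hr. rewrite (sumn_ext n _ (fun i => lsum F (fun t => at_vertex t i (fun i j k =>
    v i * (- angle_var r v i j k / sqrt (gram r i j k))) 0))).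
  - rewrite sumn_lsum.
    replace (- lsum F (tri_energy r v)) with (-1 * lsum F (tri_energy r v)) by ring.
    rewrite <- lsum_scal. apply lsum_ext. intros [[a b] c] Ht.
    destruct (tri_vertices a b c Ht) as (Ha & Hb & Hc & Hab & Hbc & Hac).
    rewrite sumn_at_vertex by assumption. unfold tri_energy, tri_form.
    rewrite <- (gram_swap r a b c), <- (gram_swap r a c b), (gram_swap_right r a b c).
    unfold Rdiv. ring.
  - intros i Hi. unfold cone_var. rewrite <- lsum_scal. apply lsum_ext. intros t Ht.
    destruct (at_vertex_spec t i) as [(j & k & Hc & E)|E]; rewrite !E; ring.
Qed.

Lemma tri_energy_nonneg r v t : adm r -> In t F -> 0 <= tri_energy r v t.
Proof.
  destruct t as [[a b] c]. intros Hr Ht. pose proof (adm_proper r a b c Hr Ht) as H.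
  apply Rdiv_le_0_compat; [now apply tri_form_semidefinite|]. apply sqrt_lt_R0, H.
Qed.

Lemma tri_energy_kernel r v t i j : adm r -> In t F -> tri_energy r v t = 0 ->
  in_tri t i -> in_tri t j -> v i = v j /\ curv T * v i = 0.
Proof.
  destruct t as [[a b] c]. intros Hr Ht E Hi Hj. pose proof (adm_proper r a b c Hr Ht) as H.
  assert (Hg : 0 < sqrt (gram r a b c)) by apply sqrt_lt_R0, H.
  assert (Hform : tri_form r v a b c = 0).
  { apply Rmult_integral in E. destruct E as [|E]; [assumption|].
    apply Rinv_0_lt_compat in Hg. lra. }
  destruct (tri_form_semidefinite r v a b c H) as [_ Hzero].
  destruct (Hzero Hform) as (Za & Zb & Zc).
  destruct (angle_var_kernel r v a b c H Za Zb Zc) as [[Eb Ec] Ecurv].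
  destruct Hi as [->|[->| ->]], Hj as [->|[->| ->]]; split; congruence.
Qed.

Theorem cone_var_semidefinite r v : adm r ->
  sumn n (fun i => v i * cone_var r v i) <= 0 /\
  (sumn n (fun i => v i * cone_var r v i) = 0 ->
   forall i j, (i < n)%nat -> (j < n)%nat -> v i = v j /\ curv T * v i = 0).
Proof.
  intros Hr. rewrite cone_var_energy by assumption.
  pose proof (fun t Ht => tri_energy_nonneg r v t Hr Ht) as Hnn. split.
  - apply lsum_nonneg in Hnn. lra.
  - intros E i j Hi Hj.
    assert (Hzero : forall t, In t F -> tri_energy r v t = 0)
      by (apply lsum_nonneg_eq_0; [assumption|lra]).
    destruct F_surface as (_ & _ & Hcover & _ & _ & Hconn). split.
    + specialize (Hconn i j Hi Hj). clear Hi Hj.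
      induction Hconn as [x y (_ & t & Ht & Hx & Hy)| |]; [|reflexivity|congruence].
      now apply (tri_energy_kernel r v t); auto.
    + destruct (Hcover i Hi) as [t [Ht Hit]].
      now apply (tri_energy_kernel r v t i i); auto.
Qed.

Lemma sn_radius_smooth j : (j < n)%nat -> smooth_on n adm (fun r => - sn T (r j)).
Proof.
  intros Hj k. replace (fun r : vec => - sn T (r j)) with (fun r : vec => -1 * sn T (r j))
    by (extensionality r; ring).
  apply Ck_mult; [apply Ck_const|]. apply Ck_sn; [exact adm_open|assumption].
Qed.

Lemma sn_radius_pos j r : (j < n)%nat -> adm r -> 0 < sn T (r j).
Proof. intros Hj Hr. now apply sn_pos, Hr. Qed.

Theorem curved_cone_local_diffeo :
  0 < curv T -> local_diffeo_between n adm adm (fun _ => True) cone.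
Proof.
  intros Hcurv.
  apply (inverse_function_scaled_posdef n adm cone (fun j r => - sn T (r j)));
    auto using adm_open, cone_smooth, sn_radius_smooth.
  - intros j r Hj Hr. pose proof (sn_radius_pos j r Hj Hr). lra.
  - intros r Hr v [i [Hi Hv]].
    rewrite (sumn_ext n _ (fun i => -1 * (v i * cone_var r v i))).
    + rewrite sumn_scal. destruct (cone_var_semidefinite r v Hr) as [Hle Hzero].
      destruct (Rle_lt_or_eq_dec _ _ Hle) as [|E]; [lra|].
      destruct (Hzero E i i Hi Hi) as [_ Z]. apply Rmult_integral in Z. lra.
    + intros l Hl. rewrite <- cone_jacobian_mulv by assumption.
      replace (mulv n (fun i j => jacobian cone r i j * - sn T (r j)) v l)
        with (-1 * mulv n (fun i j => jacobian cone r i j * sn T (r j)) v l)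
        by (unfold mulv; rewrite <- sumn_scal; apply sumn_ext; intros; ring).
      ring.
Qed.

(* Subtracting the logarithms of the radii removes the scaling direction from the kernel of the
   differential of the cone angles. *)
Definition normalized_cone (r : vec) (i : nat) : R :=
  cone r i - sumn n (fun j => ln (sn T (r j))).

Lemma normalized_cone_smooth : smooth_map_on n adm normalized_cone.
Proof.
  intros i Hi k. apply Ck_minus; [now apply cone_smooth|].
  apply (Ck_sumn n k adm n (fun j r => ln (sn T (r j)))). intros j Hj.
  apply Ck_ln; [exact adm_open|apply Ck_sn; auto using adm_open|].
  intros r Hr. now apply sn_radius_pos.
Qed.

Lemma normalized_cone_jacobian r i j : adm r -> (j < n)%nat ->
  jacobian normalized_cone r i j = jacobian cone r i j - cs T (r j) / sn T (r j).
Proof.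
  intros Hr Hj. pose proof (cone_derive r i j Hr Hj) as D.
  unfold jacobian at 2. rewrite (partial_unique j (fun r => cone r i) r _ D).
  apply (partial_unique j (fun r => normalized_cone r i)).
  apply (is_derive_Rminus (fun s => cone (upd r j s) i)); [exact D|].
  rewrite <- (sumn_kron n j (fun l => cs T (r l) / sn T (r l))) by assumption.
  apply (is_derive_sumn n (fun l s => ln (sn T (upd r j s l)))). intros l Hl.
  pose proof (sn_radius_pos l r Hl Hr) as Hpos. eapply is_derive_eq.
  - apply (is_derive_Rcomp ln); [apply is_derive_ln; now rewrite upd_id|].
    apply (is_derive_Rcomp (sn T)); [apply is_derive_sn|apply is_derive_upd].
  - rewrite upd_id, kron_sym. field. lra.
Qed.

Theorem flat_normalized_cone_local_diffeo :
  curv T = 0 -> local_diffeo_between n adm adm (fun _ => True) normalized_cone.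
Proof.
  intros Hflat.
  apply (inverse_function_scaled_posdef n adm normalized_cone (fun j r => - sn T (r j)));
    auto using adm_open, normalized_cone_smooth, sn_radius_smooth.
  - intros j r Hj Hr. pose proof (sn_radius_pos j r Hj Hr). lra.
  - intros r Hr v [i [Hi Hv]].
    rewrite (sumn_ext n _ (fun i => sumn n v * v i - v i * cone_var r v i)).
    + rewrite sumn_minus, sumn_scal.
      destruct (cone_var_semidefinite r v Hr) as [Hle Hzero].
      pose proof (Rle_0_sqr (sumn n v)) as Hsqr. unfold Rsqr in Hsqr.
      destruct (Rle_lt_or_eq_dec _ _ Hle) as [|E]; [lra|]. rewrite E.
      assert (Hsum : sumn n v = INR n * v i).
      { rewrite <- sumn_const. apply sumn_ext. intros j Hj. now apply Hzero. }
      assert (Hn : 0 < INR n) by (apply lt_0_INR; lia).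
      assert (Hne : sumn n v <> 0)
        by (rewrite Hsum; apply Rmult_integral_contrapositive; split; [lra|assumption]).
      pose proof (Rsqr_pos_lt _ Hne) as Hpos. unfold Rsqr in Hpos. lra.
    + intros l Hl. rewrite <- cone_jacobian_mulv by assumption.
      replace (mulv n (fun i j => jacobian normalized_cone r i j * - sn T (r j)) v l)
        with (sumn n v - mulv n (fun i j => jacobian cone r i j * sn T (r j)) v l); [ring|].
      unfold mulv. rewrite <- sumn_minus. apply sumn_ext. intros j Hj.
      rewrite normalized_cone_jacobian, cs_one by assumption.
      pose proof (sn_radius_pos j r Hj Hr). field. lra.
Qed.

Theorem flat_cone_sum r : curv T = 0 -> adm r -> sumn n (cone r) = PI * INR (length F).
Proof.
  intros Hflat Hr.
  rewrite (sumn_ext n _ (fun i => lsum F (fun t => at_vertex t i (angle r) 0)))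
    by (intros; now apply cone_eq).
  rewrite sumn_lsum, <- lsum_const. apply lsum_ext. intros [[a b] c] Ht.
  destruct (tri_vertices a b c Ht) as (Ha & Hb & Hc & Hab & Hbc & Hac).
  rewrite sumn_at_vertex by assumption. apply flat_angle_sum; [assumption|].
  now apply adm_proper.
Qed.

End Circle_packing.

(** * The Euclidean and the hyperbolic plane *)

Lemma is_derive_cst_one (x : R) : is_derive (fun _ : R => 1) x (0 * x).
Proof. rewrite Rmult_0_l. apply is_derive_Rconst. Qed.

Lemma one_sqr (x : R) : 1 * 1 = 1 + 0 * (x * x).
Proof. ring. Qed.

Definition euclidean : trigonometry := {|
  curv := 0; sn := fun x => x; cs := fun _ => 1;
  curv_nonneg := Rle_refl 0; sn_pos := fun _ H => H; cs_pos := fun _ => Rlt_0_1;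
  cs_sqr := one_sqr; is_derive_sn := is_derive_id; is_derive_cs := is_derive_cst_one |}.

Lemma sinh_pos x : 0 < x -> 0 < sinh x.
Proof. intros H. rewrite <- sinh_0. now apply sinh_lt. Qed.

Lemma cosh_pos x : 0 < cosh x.
Proof. unfold cosh. pose proof (exp_pos x). pose proof (exp_pos (- x)). lra. Qed.

Lemma cosh_plus x y : cosh (x + y) = cosh x * cosh y + sinh x * sinh y.
Proof. unfold cosh, sinh. rewrite Ropp_plus_distr, !exp_plus. field. Qed.

Lemma cosh_minus x y : cosh (x - y) = cosh x * cosh y - sinh x * sinh y.
Proof.
  unfold Rminus. rewrite cosh_plus. unfold cosh, sinh. rewrite Ropp_involutive. field.
Qed.

Lemma cosh_sqr x : cosh x * cosh x = 1 + 1 * (sinh x * sinh x).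
Proof. pose proof (cosh_minus x x) as E. rewrite Rminus_diag, cosh_0 in E. lra. Qed.

Lemma is_derive_sinh x : is_derive sinh x (cosh x).
Proof. apply is_derive_Reals, derivable_pt_lim_sinh. Qed.

Lemma is_derive_cosh x : is_derive cosh x (1 * sinh x).
Proof. rewrite Rmult_1_l. apply is_derive_Reals, derivable_pt_lim_cosh. Qed.

Definition hyperbolic : trigonometry := {|
  curv := 1; sn := sinh; cs := cosh;
  curv_nonneg := Rle_0_1; sn_pos := sinh_pos; cs_pos := cosh_pos;
  cs_sqr := cosh_sqr; is_derive_sn := is_derive_sinh; is_derive_cs := is_derive_cosh |}.

Lemma lenE_eq I r i j : lenE I r i j = sqrt (sn2_side euclidean I r i j).
Proof. unfold lenE, sn2_side. cbn [curv sn cs euclidean]. f_equal. ring. Qed.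

Lemma euclidean_cos_num I r i j k : 2 * cos_num euclidean I r i j k
  = sn2_side euclidean I r i j + sn2_side euclidean I r i k - sn2_side euclidean I r j k.
Proof. unfold cos_num, sn2_side. cbn [curv sn cs euclidean]. ring. Qed.

Lemma sqrt_sn2_side T I r i j : 0 < r i -> 0 < r j -> 0 <= I i j ->
  0 < sqrt (sn2_side T I r i j) /\
  sn2_side T I r i j = sqrt (sn2_side T I r i j) * sqrt (sn2_side T I r i j).
Proof.
  intros Hi Hj HI. pose proof (sn2_side_pos T I r i j Hi Hj HI).
  split; [now apply sqrt_lt_R0|]. symmetry. apply sqrt_sqrt. lra.
Qed.

Lemma euclidean_gram_pos I r i j k : 0 < r i -> 0 < r j -> 0 < r k ->
  0 <= I i j -> 0 <= I i k -> 0 <= I j k ->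
  lenE I r i j < lenE I r i k + lenE I r j k -> lenE I r i k < lenE I r i j + lenE I r j k ->
  lenE I r j k < lenE I r i j + lenE I r i k -> 0 < gram euclidean I r i j k.
Proof.
  intros Hi Hj Hk Hij Hik Hjk. rewrite !lenE_eq.
  destruct (sqrt_sn2_side euclidean I r i j Hi Hj Hij) as [Pa Ea].
  destruct (sqrt_sn2_side euclidean I r i k Hi Hk Hik) as [Pb Eb].
  destruct (sqrt_sn2_side euclidean I r j k Hj Hk Hjk) as [Pc Ec].
  pose proof (euclidean_cos_num I r i j k) as En. rewrite Ea, Eb, Ec in En.
  intros Htri_ij Htri_ik Htri_jk.
  unfold gram. rewrite Ea, Eb.
  set (a := sqrt (sn2_side euclidean I r i j)) in *.
  set (b := sqrt (sn2_side euclidean I r i k)) in *.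
  set (c := sqrt (sn2_side euclidean I r j k)) in *.
  replace (cos_num euclidean I r i j k) with ((a * a + b * b - c * c) / 2) by lra.
  replace (a * a * (b * b) - (a * a + b * b - c * c) / 2 * ((a * a + b * b - c * c) / 2))
    with ((a + b + c) * (a + b - c) * ((c + a - b) * (c + b - a)) / 4) by field.
  apply Rdiv_lt_0_compat; [|lra].
  apply Rmult_lt_0_compat; apply Rmult_lt_0_compat; lra.
Qed.

Lemma euclidean_laws I : (forall i j, I i j = I j i) -> metric_laws euclidean I (lenE I) angE.
Proof.
  intros I_sym. split.
  - intros r i j. now rewrite !lenE_eq, sn2_side_sym.
  - intros n U i j HU Hi Hj HI Hpos.
    apply (cont_on_ext n U (fun r => sqrt (sn2_side euclidean I r i j)));
      [intros; now rewrite lenE_eq|].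
    apply (Ck_cont n 0), Ck_sqrt; [assumption|now apply Ck_sn2_side|].
    intros r Ur. destruct (Hpos r Ur). now apply sn2_side_pos.
  - exact (euclidean_gram_pos I).
  - intros r i j k ((Hi & Hj & Hk) & (Hij & Hik & Hjk) & _).
    unfold angE, angle. rewrite !lenE_eq. f_equal.
    destruct (sqrt_sn2_side euclidean I r i j Hi Hj Hij) as [Pij _].
    destruct (sqrt_sn2_side euclidean I r i k Hi Hk Hik) as [Pik _].
    rewrite !pow2_sqrt by (left; now apply sn2_side_pos).
    rewrite <- (euclidean_cos_num I r i j k). field. lra.
Qed.

Lemma arcosh_arcsinh x : 1 <= x -> arcosh x = arcsinh (sqrt (x ^ 2 - 1)).
Proof.
  intros H. unfold arcosh, arcsinh. rewrite pow2_sqrt by nra.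
  replace (x ^ 2 - 1 + 1) with (x ^ 2) by ring. rewrite sqrt_pow2 by lra. f_equal. ring.
Qed.

Lemma lenH_eq I r i j : 0 < r i -> 0 < r j -> 0 <= I i j ->
  lenH I r i j = arcsinh (sqrt (sn2_side hyperbolic I r i j)).
Proof.
  intros Hi Hj HI. pose proof (cs_side_ge_1 hyperbolic I r i j Hi Hj HI) as Hcs.
  pose proof (curv_sn2_side hyperbolic I r i j) as E. change (curv hyperbolic) with 1 in E.
  unfold lenH. replace (cosh (r i) * cosh (r j) + _) with (cs_side hyperbolic I r i j)
    by (unfold cs_side; cbn [curv sn cs hyperbolic]; ring).
  rewrite arcosh_arcsinh by assumption. do 2 f_equal. lra.
Qed.

Lemma lenH_sinh_cosh I r i j : 0 < r i -> 0 < r j -> 0 <= I i j ->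
  0 < lenH I r i j /\ sinh (lenH I r i j) = sqrt (sn2_side hyperbolic I r i j) /\
  cosh (lenH I r i j) = cs_side hyperbolic I r i j.
Proof.
  intros Hi Hj HI. destruct (sqrt_sn2_side hyperbolic I r i j Hi Hj HI) as [Hpos Hsqr].
  rewrite lenH_eq by assumption. rewrite sinh_arcsinh. split; [|split; [reflexivity|]].
  - rewrite <- arcsinh_0. now apply arcsinh_lt.
  - pose proof (cosh_sqr (arcsinh (sqrt (sn2_side hyperbolic I r i j)))) as Ec.
    rewrite sinh_arcsinh, <- Hsqr in Ec.
    pose proof (curv_sn2_side hyperbolic I r i j) as E. change (curv hyperbolic) with 1 in E.
    pose proof (cs_side_ge_1 hyperbolic I r i j Hi Hj HI).
    pose proof (cosh_pos (arcsinh (sqrt (sn2_side hyperbolic I r i j)))). nra.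
Qed.

Lemma cosh_increasing x y : Rabs x < y -> cosh x < cosh y.
Proof.
  intros H. apply Rabs_def2 in H.
  pose proof (sinh_pos ((y + x) / 2) ltac:(lra)) as Sp.
  pose proof (sinh_pos ((y - x) / 2) ltac:(lra)) as Sm.
  pose proof (cosh_plus ((y + x) / 2) ((y - x) / 2)) as Ep.
  pose proof (cosh_minus ((y + x) / 2) ((y - x) / 2)) as Em.
  replace ((y + x) / 2 + (y - x) / 2) with y in Ep by field.
  replace ((y + x) / 2 - (y - x) / 2) with x in Em by field.
  pose proof (Rmult_lt_0_compat _ _ Sp Sm). lra.
Qed.

Lemma hyperbolic_cos_num I r i j k : 0 < r i -> 0 < r j -> 0 < r k ->
  0 <= I i j -> 0 <= I i k -> 0 <= I j k ->
  cos_num hyperbolic I r i j k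
  = cosh (lenH I r i j) * cosh (lenH I r i k) - cosh (lenH I r j k).
Proof.
  intros Hi Hj Hk Hij Hik Hjk.
  destruct (lenH_sinh_cosh I r i j Hi Hj Hij) as (_ & _ & ->).
  destruct (lenH_sinh_cosh I r i k Hi Hk Hik) as (_ & _ & ->).
  destruct (lenH_sinh_cosh I r j k Hj Hk Hjk) as (_ & _ & ->).
  rewrite <- curv_cos_num. change (curv hyperbolic) with 1. ring.
Qed.

Lemma hyperbolic_gram_pos I r i j k : 0 < r i -> 0 < r j -> 0 < r k ->
  0 <= I i j -> 0 <= I i k -> 0 <= I j k ->
  lenH I r i j < lenH I r i k + lenH I r j k -> lenH I r i k < lenH I r i j + lenH I r j k ->
  lenH I r j k < lenH I r i j + lenH I r i k -> 0 < gram hyperbolic I r i j k.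
Proof.
  intros Hi Hj Hk Hij Hik Hjk Htri_ij Htri_ik Htri_jk.
  destruct (sqrt_sn2_side hyperbolic I r i j Hi Hj Hij) as [_ Sa].
  destruct (sqrt_sn2_side hyperbolic I r i k Hi Hk Hik) as [_ Sb].
  destruct (lenH_sinh_cosh I r i j Hi Hj Hij) as (Pa & Ea & _).
  destruct (lenH_sinh_cosh I r i k Hi Hk Hik) as (Pb & Eb & _).
  destruct (lenH_sinh_cosh I r j k Hj Hk Hjk) as (Pc & _ & _).
  unfold gram. rewrite Sa, Sb, <- Ea, <- Eb, hyperbolic_cos_num by assumption.
  set (a := lenH I r i j) in *. set (b := lenH I r i k) in *. set (c := lenH I r j k) in *.
  assert (Hplus : cosh c < cosh (a + b)) by (apply cosh_increasing; rewrite Rabs_right; lra).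
  assert (Hminus : cosh (a - b) < cosh c) by (apply cosh_increasing; apply Rabs_def1; lra).
  rewrite cosh_plus in Hplus. rewrite cosh_minus in Hminus.
  replace (_ - _) with ((sinh a * sinh b - (cosh a * cosh b - cosh c))
    * (sinh a * sinh b + (cosh a * cosh b - cosh c))) by ring.
  apply Rmult_lt_0_compat; lra.
Qed.

Lemma cont_on_arcsinh n U h : cont_on n U h -> cont_on n U (fun x => arcsinh (h x)).
Proof.
  rewrite !cont_on_filterlim. intros H x Hx.
  apply (filterlim_comp _ _ _ h arcsinh _ (locally (h x))); [now apply H|].
  apply (ex_derive_continuous arcsinh). eexists. apply is_derive_Reals, derivable_pt_lim_arcsinh.
Qed.

Lemma hyperbolic_laws I : (forall i j, I i j = I j i) -> metric_laws hyperbolic I (lenH I) angH.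
Proof.
  intros I_sym. split.
  - intros r i j. unfold lenH. rewrite (I_sym j i). f_equal. ring.
  - intros n U i j HU Hi Hj HI Hpos.
    apply (cont_on_ext n U (fun r => arcsinh (sqrt (sn2_side hyperbolic I r i j))));
      [intros r Ur; destruct (Hpos r Ur); now rewrite lenH_eq|].
    apply cont_on_arcsinh, (Ck_cont n 0), Ck_sqrt; [assumption|now apply Ck_sn2_side|].
    intros r Ur. destruct (Hpos r Ur). now apply sn2_side_pos.
  - exact (hyperbolic_gram_pos I).
  - intros r i j k ((Hi & Hj & Hk) & (Hij & Hik & Hjk) & _).
    unfold angH, angle. f_equal. rewrite hyperbolic_cos_num by assumption.
    destruct (lenH_sinh_cosh I r i j Hi Hj Hij) as (_ & -> & _).
    now destruct (lenH_sinh_cosh I r i k Hi Hk Hik) as (_ & -> & _).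
Qed.

(** * Scaling and normalization *)

Lemma lenE_scale I r c i j : 0 < c -> lenE I (scale c r) i j = c * lenE I r i j.
Proof.
  intros Hc. unfold lenE, scale.
  replace ((c * r i) ^ 2 + (c * r j) ^ 2 + 2 * (c * r i) * (c * r j) * I i j)
    with (c ^ 2 * (r i ^ 2 + r j ^ 2 + 2 * r i * r j * I i j)) by ring.
  rewrite sqrt_mult_alt by apply pow2_ge_0. now rewrite sqrt_pow2 by lra.
Qed.

Lemma angE_scale c x y z : 0 < c -> angE (c * x) (c * y) (c * z) = angE x y z.
Proof.
  intros Hc. unfold angE. f_equal.
  replace ((c * x) ^ 2 + (c * y) ^ 2 - (c * z) ^ 2) with (c ^ 2 * (x ^ 2 + y ^ 2 - z ^ 2)) by ring.
  replace (2 * (c * x) * (c * y)) with (c ^ 2 * (2 * x * y)) by ring.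
  apply Rdiv_mult_l_l. apply pow_nonzero. lra.
Qed.

Lemma coneE_scale F I r c i : 0 < c -> coneE F I (scale c r) i = coneE F I r i.
Proof.
  intros Hc. apply (lsum_ext F (fun t => angle_at angE (lenE I (scale c r)) t i)
    (fun t => angle_at angE (lenE I r) t i)).
  intros [[a b] d] _. unfold angle_at. rewrite !lenE_scale by assumption.
  now rewrite !angE_scale by assumption.
Qed.

Lemma admE_scale n F I r c : 0 < c -> admE n F I r -> admE n F I (scale c r).
Proof.
  intros Hc [Hp Ht]. split.
  - intros i Hi. apply Rmult_lt_0_compat; auto.
  - intros a b d Hin. rewrite !lenE_scale by assumption.
    destruct (Ht a b d Hin) as (Htri_ab & Htri_bd & Htri_da).
    rewrite <- !Rmult_plus_distr_l. repeat split; now apply Rmult_lt_compat_l.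
Qed.

Lemma prodn_pos n r : (forall i, (i < n)%nat -> 0 < r i) -> 0 < prodn n r.
Proof.
  induction n as [|n IH]; intros H; simpl; [lra|].
  apply Rmult_lt_0_compat; [apply IH; intros|]; apply H; lia.
Qed.

Lemma ln_prodn n r :
  (forall i, (i < n)%nat -> 0 < r i) -> ln (prodn n r) = sumn n (fun i => ln (r i)).
Proof.
  induction n as [|n IH]; intros H; simpl; [apply ln_1|].
  rewrite ln_mult, IH; auto. apply prodn_pos. auto.
Qed.

Lemma prodn_eq_1 n r : (forall i, (i < n)%nat -> 0 < r i) ->
  prodn n r = 1 <-> INR n * sumn n (fun i => ln (r i)) = 0.
Proof.
  intros H. rewrite <- ln_prodn by assumption. split.
  - intros ->. rewrite ln_1. ring.
  - intros E. destruct n as [|n]; [reflexivity|]. apply Rmult_integral in E.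
    destruct E as [E|E]; [now apply (not_0_INR (S n)) in E|].
    rewrite <- (exp_ln (prodn (S n) r)), E by now apply prodn_pos. apply exp_0.
Qed.

Lemma prodn_scale n c r : prodn n (scale c r) = c ^ n * prodn n r.
Proof.
  induction n as [|n IH]; simpl; [ring|]. rewrite IH. unfold scale. ring.
Qed.

Definition unit_factor (n : nat) (r : vec) : R := exp (- (sumn n (fun i => ln (r i)) / INR n)).

Lemma prodn_unit_factor n r :
  (forall i, (i < n)%nat -> 0 < r i) -> prodn n (scale (unit_factor n r) r) = 1.
Proof.
  intros Hr. destruct n as [|n]; [reflexivity|].
  rewrite prodn_scale, <- (exp_ln (prodn (S n) r)), ln_prodn by auto using prodn_pos.
  unfold unit_factor. rewrite <- Rpower_pow by apply exp_pos.
  unfold Rpower. rewrite ln_exp, <- exp_plus, <- exp_0. f_equal. field. now apply not_0_INR.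
Qed.

Lemma unit_factor_cont n U :
  open_n n U -> (forall r i, U r -> (i < n)%nat -> 0 < r i) -> cont_on n U (unit_factor n).
Proof.
  intros HU Hpos. apply (Ck_cont n 0), (Ck_comp1 n 0 U (fun _ => True) exp);
    auto using open_true, Ck1_exp.
  replace (fun r => - (sumn n (fun i => ln (r i)) / INR n))
    with (fun r : vec => - / INR n * sumn n (fun i => ln (r i)))
    by (extensionality r; unfold Rdiv; ring).
  apply Ck_mult; [apply Ck_const|]. apply (Ck_sumn n 0 U n (fun i r => ln (r i))).
  intros i Hi. apply Ck_ln; auto using Ck_proj.
Qed.

(** * Inversive distance circle packings *)

Section Inversive_distance.

Variables (n : nat) (F : list tri) (I : nat -> nat -> R).
Hypothesis F_surface : closed_tri_surface n F.
Hypothesis I_sym : forall i j, I i j = I j i.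
Hypothesis I_nonneg : forall i j, is_edge F i j -> 0 <= I i j.

Theorem euclidean_local_diffeo :
  local_diffeo_between n (admE n F I) (fun r => admE n F I r /\ prodn n r = 1)
    (fun x => sumn n x = PI * INR (length F)) (coneE F I).
Proof.
  pose proof (euclidean_laws I I_sym) as laws.
  set (f := normalized_cone euclidean (lenE I) angE n F).
  assert (Hsum : forall r, admE n F I r ->
    sumn n (f r) = PI * INR (length F) - INR n * sumn n (fun i => ln (r i))).
  { intros r Hr. unfold f, normalized_cone. rewrite sumn_minus, sumn_const. f_equal.
    now apply (flat_cone_sum euclidean I I_sym _ _ laws n F). }
  apply (local_diffeo_restrict n (admE n F I) _ _ f).
  - now apply (flat_normalized_cone_local_diffeo euclidean I I_sym).
  - now apply (cone_smooth euclidean I I_sym _ _ laws n F).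
  - intros x y E <-. apply sumn_ext. intros i Hi. symmetry. now apply E.
  - intros r. split; intros [Hr E]; (split; [assumption|]).
    + rewrite Hsum by assumption. apply prodn_eq_1 in E; [lra|apply Hr].
    + rewrite Hsum in E by assumption. apply prodn_eq_1; [apply Hr|lra].
  - intros r [Hr E]. extensionality i. unfold f, normalized_cone.
    change (sumn n (fun j => ln (sn euclidean (r j)))) with (sumn n (fun j => ln (r j))).
    rewrite <- ln_prodn, E, ln_1 by apply Hr. apply Rminus_0_r.
Qed.

Theorem euclidean_rigidity r : admE n F I r ->
  exists U : vec -> Prop, open_n n U /\ U r /\
    forall r', U r' -> admE n F I r' -> eqn n (coneE F I r') (coneE F I r) ->
      exists c, 0 < c /\ eqn n r' (scale c r).
Proof.
  intros Hr. set (unit := fun r => scale (unit_factor n r) r).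
  assert (Hpos : forall r, 0 < unit_factor n r) by (intros; apply exp_pos).
  assert (Hunit : forall r, admE n F I r -> admE n F I (unit r) /\ prodn n (unit r) = 1)
    by (intros s Hs; split; [now apply admE_scale|now apply prodn_unit_factor, Hs]).
  destruct (local_diffeo_locally_injective _ _ _ _ _ _ euclidean_local_diffeo (Hunit r Hr))
    as (U & HU & Ur & Hinj).
  exists (fun r => admE n F I r /\ U (unit r)). split; [|split; [auto|]].
  - assert (Hopen : open_n n (admE n F I))
      by exact (adm_open euclidean I I_sym _ _ (euclidean_laws I I_sym) n F F_surface I_nonneg).
    apply (open_n_preimage n _ n U (fun i r => unit r i)); try assumption.
    intros i Hi. apply cont_on_mult; [|now apply cont_on_proj].
    apply unit_factor_cont; [assumption|]. intros s j Hs. apply Hs.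
  - intros r' [_ Ur'] Hr' E.
    assert (Eunit : eqn n (unit r') (unit r)).
    { apply Hinj; auto. intros i Hi. unfold unit. rewrite !coneE_scale by auto. now apply E. }
    exists (unit_factor n r / unit_factor n r'). split; [now apply Rdiv_lt_0_compat|].
    intros i Hi. specialize (Eunit i Hi). unfold unit, scale in *.
    pose proof (Hpos r'). apply Rmult_eq_reg_l with (unit_factor n r'); [|lra].
    rewrite Eunit. field. lra.
Qed.

Theorem hyperbolic_local_diffeo :
  local_diffeo_between n (admH n F I) (admH n F I) (fun _ => True) (coneH F I).
Proof.
  exact (curved_cone_local_diffeo hyperbolic I I_sym _ _ (hyperbolic_laws I I_sym) n F
    F_surface I_nonneg Rlt_0_1).
Qed.

End Inversive_distance.

Theorem theorem1p2 (n : nat) (F : list tri) (I : nat -> nat -> R)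
  (HS : closed_tri_surface n F)
  (HIsym : forall i j, I i j = I j i)
  (HI : forall i j, is_edge F i j -> 0 <= I i j) :
  (* Euclidean case *)
  ((forall r c, admE n F I r -> 0 < c ->
      admE n F I (scale c r) /\ eqn n (coneE F I (scale c r)) (coneE F I r)) /\
   local_diffeo_between n (admE n F I)
     (fun r => admE n F I r /\ prodn n r = 1)
     (fun x => sumn n x = PI * INR (length F))
     (coneE F I) /\
   (forall r, admE n F I r -> exists (U : (nat -> R) -> Prop), open_n n U /\ U r /\
      forall r', U r' -> admE n F I r' -> eqn n (coneE F I r') (coneE F I r) ->
        exists c, 0 < c /\ eqn n r' (scale c r))) /\
  (* Hyperbolic case *)
  (local_diffeo_between n (admH n F I) (admH n F I) (fun _ => True) (coneH F I) /\
   (forall r, admH n F I r -> exists (U : (nat -> R) -> Prop), open_n n U /\ U r /\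
      forall r1 r2, U r1 -> U r2 -> admH n F I r1 -> admH n F I r2 ->
        eqn n (coneH F I r1) (coneH F I r2) -> eqn n r1 r2)).
Proof.
  pose proof (hyperbolic_local_diffeo n F I HS HIsym HI) as Hhyp.
  split; [split; [|split]|split].
  - intros r c Hr Hc. split; [now apply admE_scale|]. intros i _. now apply coneE_scale.
  - now apply euclidean_local_diffeo.
  - now apply euclidean_rigidity.
  - exact Hhyp.
  - intros r Hr. destruct (local_diffeo_locally_injective _ _ _ _ _ _ Hhyp Hr)
      as (U & HU & Ur & Hinj).
    exists U. auto.
Qed.
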